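(* Let $\kappa$ be a strictly positive definite kernel on a locally compact Hausdorff space $X$ and let $\mathbf A=(A_i)_{i\in I}$ be a generalized condenser in $X$ with $c_\kappa(A_i)>0$ for all $i\in I$. Then $\mathcal E^+_\kappa(\mathbf A)$ is a semimetric space with the semimetric defined by either of the (equivalent) relations $$\|\boldsymbol\mu-\boldsymbol\mu_1\|_{\mathcal E^+_\kappa(\mathbf A)}:=\|R\boldsymbol\mu-R\boldsymbol\mu_1\|_\kappa,\qquad \|\boldsymbol\mu-\boldsymbol\mu_1\|^2_{\mathcal E^+_\kappa(\mathbf A)}=\sum_{i,j\in I}s_is_j\,\kappa(\mu^i-\mu_1^i,\mu^j-\mu_1^j),\quad \boldsymbol\mu,\boldsymbol\mu_1\in\mathcal E^+_\kappa(\mathbf A),$$ and this space is isometric to its $R$-image in $\mathcal E_\kappa(X)$. The semimetric $\|\boldsymbol\mu-\boldsymbol\mu_1\|_{\mathcal E^+_\kappa(\mathbf A)}$ is a metric on $\mathcal E^+_\kappa(\mathbf A)$ if and only if all the $A_i$, $i\in I$, are mutually essentially disjoint, i.e. $c_\kappa(A_i\cap A_j)=0$ for all $i\ne j$.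
   Context: $\mathfrak M(X)$ is the space of real-valued (signed) scalar Radon measures on $X$, $\mathfrak M^+(X)$ the cone of positive ones, $\mu^\pm$ the positive and negative parts of $\mu$. $\Psi(X)$ is the set of lower semicontinuous functions $X\to(-\infty,\infty]$, required to be nonnegative unless $X$ is compact. A kernel on $X$ is a symmetric function $\kappa\in\Psi(X\times X)$. The mutual energy is $\kappa(\mu,\nu)=\iint\kappa(x,y)\,d\mu(x)\,d\nu(y)$ (when well defined) and the energy of $\mu$ is $\kappa(\mu,\mu)$. $\mathcal E_\kappa(X)$ is the set of $\mu\in\mathfrak M(X)$ for which $\kappa(\mu^+,\mu^+),\kappa(\mu^-,\mu^-),\kappa(\mu^+,\mu^-)$ are all finite. $\kappa$ is strictly positive definite if $\kappa(\mu,\mu)\ge0$ for all $\mu\in\mathfrak M(X)$ for which it is defined, with equality only for $\mu=0$; then $\mathcal E_\kappa(X)$ is a pre-Hilbert space with inner product $\kappa(\mu,\nu)$ and norm $\|\mu\|_\kappa=\sqrt{\kappa(\mu,\mu)}$. The (inner) capacity of $Q\subset X$ is $c_\kappa(Q)=[\inf\kappa(\mu,\mu)]^{-1}$, the infimum being over all positive $\mu\in\mathcal E_\kappa(X)$ carried by $Q$ with $\mu(Q)=1$ (with $\inf\varnothing=+\infty$, $1/(+\infty)=0$, $1/0=+\infty$). Generalized condenser: a finite ordered collection $\mathbf A=(A_i)_{i\in I}$ of nonempty closed sets $A_i\subset X$, each with a prescribed sign $s_i=\pm1$, such that $c_\kappa(A^+\cap A^-)=0$, where $A^+=\bigcup_{s_i=+1}A_i$,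 $A^-=\bigcup_{s_i=-1}A_i$ (equally signed plates may intersect arbitrarily or coincide). $\mathcal E^+_\kappa(\mathbf A)$ is the set of all vector measures $\boldsymbol\mu=(\mu^i)_{i\in I}$ with $\mu^i\in\mathfrak M^+(X)$ supported by $A_i$ and $\kappa(\mu^i,\mu^i)<\infty$ for every $i\in I$. For such $\boldsymbol\mu$, $R\boldsymbol\mu:=\sum_{i\in I}s_i\mu^i\in\mathcal E_\kappa(X)$. *)

(* Defs.v *)
From mathcomp Require Import all_boot all_order all_algebra.
From mathcomp Require Import all_classical all_reals all_analysis.

Set Implicit Arguments.
Unset Strict Implicit.
Unset Printing Implicit Defensive.
Import Order.TTheory GRing.Theory Num.Theory.

Local Open Scope classical_set_scope.
Local Open Scope ring_scope.
Local Open Scope ereal_scope.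

Notation Borel X := (g_sigma_algebraType (@open X)).

(* Positive Radon measures are taken in their inner regular Borel version, so
   that locally null Borel sets are null. *)
Definition is_radon (R : realType) (X : ptopologicalType)
    (m : {measure set (Borel X) -> \bar R}) : Prop :=
  (forall K : set X, compact K -> m K < +oo) /\
  (forall B : set (Borel X), measurable B ->
    m B = ereal_sup [set m K | K in [set K : set X | compact K /\ K `<=` B]]).

Definition bounded_borel (X : ptopologicalType) : set (set X) :=
  [set B | measurable (B : set (Borel X)) /\
           exists2 K : set X, compact K & B `<=` K].

(* A signed Radon measure may have infinite positive and negative mass, so it
   has a real value only on relatively compact Borel sets. It is identified
   with the function of these values; the value 0 on all other sets is a
   convention which makes equality of measures equality of functions. *)
Definition radonM (R : realType) (X : ptopologicalType) : set (set X -> R) :=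
  [set mu | exists p q : {measure set (Borel X) -> \bar R},
    [/\ is_radon p, is_radon q,
        forall B, bounded_borel B -> (mu B)%:E = p B - q B &
        forall B, ~ bounded_borel B -> mu B = 0%R]].

Definition radonMpos (R : realType) (X : ptopologicalType) : set (set X -> R) :=
  [set mu | radonM mu /\ forall B, (0 <= mu B)%R].

(* mu^+ and mu^- as Borel measures on X. *)
Definition pospart (R : realType) (X : ptopologicalType) (mu : set X -> R)
    (B : set (Borel X)) : \bar R :=
  ereal_sup [set (mu C)%:E | C in [set C | bounded_borel C /\ C `<=` B]].

Definition negpart (R : realType) (X : ptopologicalType) (mu : set X -> R) :
    set (Borel X) -> \bar R :=
  pospart (fun B => - mu B)%R.

Definition totvar (R : realType) (X : ptopologicalType) (mu : set X -> R)
    (B : set (Borel X)) : \bar R :=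
  pospart mu B + negpart mu B.

Definition msupport (R : realType) (X : ptopologicalType) (mu : set X -> R) :
    set X :=
  [set x | forall U : set X, open U -> U x -> 0 < totvar mu U].

Definition supported_by (R : realType) (X : ptopologicalType)
    (mu : set X -> R) (A : set X) : Prop :=
  msupport mu `<=` A.

Definition carried_by (R : realType) (X : ptopologicalType)
    (mu : set X -> R) (Q : set X) : Prop :=
  forall K : set X, compact K -> negligible (totvar mu) (K `\` Q).

Definition Psi (R : realType) (T : topologicalType) : set (T -> \bar R) :=
  [set f | [/\ lower_semicontinuous f, forall x, f x != -oo &
               ~ compact [set: T] -> forall x, 0 <= f x]].

Definition potential_kernel (R : realType) (X : ptopologicalType)
    (k : X * X -> \bar R) : Prop :=
  Psi k /\ forall x y, k (x, y) = k (y, x).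

Definition iint (R : realType) (X : ptopologicalType) (k : X * X -> \bar R)
    (m n : set (Borel X) -> \bar R) : \bar R :=
  \int[m]_x \int[n]_y k (x, y).

Definition mutual_energy (R : realType) (X : ptopologicalType)
    (k : X * X -> \bar R) (mu nu : set X -> R) : \bar R :=
  (iint k (pospart mu) (pospart nu) + iint k (negpart mu) (negpart nu)) -
  (iint k (pospart mu) (negpart nu) + iint k (negpart mu) (pospart nu)).

(* The difference in mutual_energy is not of the form +oo - +oo. *)
Definition mutual_energy_defined (R : realType) (X : ptopologicalType)
    (k : X * X -> \bar R) (mu nu : set X -> R) : Prop :=
  (iint k (pospart mu) (pospart nu) + iint k (negpart mu) (negpart nu)
     \is a fin_num) \/
  (iint k (pospart mu) (negpart nu) + iint k (negpart mu) (pospart nu)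
     \is a fin_num).

Definition energy (R : realType) (X : ptopologicalType)
    (k : X * X -> \bar R) (mu : set X -> R) : \bar R :=
  mutual_energy k mu mu.

Definition finite_energy (R : realType) (X : ptopologicalType)
    (k : X * X -> \bar R) : set (set X -> R) :=
  [set mu | [/\ radonM mu,
    iint k (pospart mu) (pospart mu) \is a fin_num,
    iint k (negpart mu) (negpart mu) \is a fin_num &
    iint k (pospart mu) (negpart mu) \is a fin_num]].

Definition strictly_positive_definite (R : realType) (X : ptopologicalType)
    (k : X * X -> \bar R) : Prop :=
  forall mu : set X -> R, radonM mu -> mutual_energy_defined k mu mu ->
    0 <= energy k mu /\ (energy k mu = 0 -> mu = (fun=> 0%R)).

Definition energy_norm (R : realType) (X : ptopologicalType)
    (k : X * X -> \bar R) (mu : set X -> R) : R :=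
  Num.sqrt (fine (energy k mu)).

(* For an arbitrary Q, pospart mu Q is the inner measure of Q, which is mu(Q)
   when mu is positive and carried by Q. The extended inverse satisfies
   +oo^-1 = 0 and 0^-1 = +oo. *)
Definition capacity (R : realType) (X : ptopologicalType)
    (k : X * X -> \bar R) (Q : set X) : \bar R :=
  (ereal_inf [set energy k mu | mu in
     [set mu : set X -> R | [/\ radonMpos mu, finite_energy k mu,
                                carried_by mu Q & pospart mu Q = 1]]])^-1.

Definition same_sign (R : realType) (X : ptopologicalType) (I : finType)
    (A : I -> set X) (s : I -> R) (e : R) : set X :=
  \bigcup_(i in [set i | s i = e]) A i.

Definition generalized_condenser (R : realType) (X : ptopologicalType)
    (k : X * X -> \bar R) (I : finType) (A : I -> set X) (s : I -> R) : Prop :=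
  [/\ forall i, A i !=set0, forall i, closed (A i),
      forall i, s i = 1%R \/ s i = (- 1)%R &
      capacity k (same_sign A s 1 `&` same_sign A s (- 1)) = 0].

Definition vector_measures (R : realType) (X : ptopologicalType)
    (k : X * X -> \bar R) (I : finType) (A : I -> set X) :
    set (I -> set X -> R) :=
  [set mu | forall i, [/\ radonMpos (mu i), supported_by (mu i) (A i) &
                          energy k (mu i) < +oo]].

Definition Rmap (R : realType) (X : ptopologicalType) (I : finType)
    (s : I -> R) (mu : I -> set X -> R) : set X -> R :=
  fun B => (\sum_i s i * mu i B)%R.

Definition energy_dist (R : realType) (X : ptopologicalType)
    (k : X * X -> \bar R) (mu nu : set X -> R) : R :=
  energy_norm k (mu \- nu)%R.

Definition vector_dist (R : realType) (X : ptopologicalType)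
    (k : X * X -> \bar R) (I : finType) (s : I -> R)
    (mu nu : I -> set X -> R) : R :=
  energy_norm k (Rmap s mu \- Rmap s nu)%R.

Definition semimetric_on (R : realType) (T : Type) (S : set T)
    (d : T -> T -> R) : Prop :=
  [/\ forall x y, S x -> S y -> (0 <= d x y)%R,
      forall x, S x -> d x x = 0%R,
      forall x y, S x -> S y -> d x y = d y x &
      forall x y z, S x -> S y -> S z -> (d x z <= d x y + d y z)%R].

Definition metric_on (R : realType) (T : Type) (S : set T)
    (d : T -> T -> R) : Prop :=
  semimetric_on S d /\ forall x y, S x -> S y -> d x y = 0%R -> x = y.

(* Injectivity is not required: f may identify points of S at distance 0. *)
Definition isometry_onto (R : realType) (T U : Type) (S : set T)
    (d : T -> T -> R) (S' : set U) (d' : U -> U -> R) (f : T -> U) : Prop :=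
  f @` S = S' /\ forall x y, S x -> S y -> d' (f x) (f y) = d x y.

(* Main.v *)
(* The mutual energy is biadditive on E_k(X), and positive on the diagonal, so that
   the energy norm of differences of R-images is a semimetric. Biadditivity rests on
   the lower semicontinuity of the potentials x |-> int k(x, y) dn(y) of Radon
   measures; Fubini's theorem is avoided, since the triangle inequality does not need
   the energy form to be symmetric. Positive measures m, n of finite energy have a
   finite mutual energy because the energy of m - n is nonnegative.
   For the last equivalence, a set of capacity zero is null for every positive measure
   of finite energy, for otherwise the normalised restriction to a compact subset would
   have finite energy. If the plates are essentially disjoint, strict positivity
   recovers Rmu from its norm and then each component by restriction to its plate.
   Conversely, a measure of finite energy carried by two equally signed plates may be
   put on either of them without changing the R-image. *)
From HB Require Import structures.
Require Import Defs.
From mathcomp Require Import all_boot all_order all_algebra.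
From mathcomp Require Import all_classical all_reals all_analysis measurable_realfun.
From mathcomp Require Import ring lra.

Set Implicit Arguments.
Unset Strict Implicit.
Unset Printing Implicit Defensive.
Import Order.TTheory GRing.Theory Num.Theory.
Local Open Scope classical_set_scope.
Local Open Scope ring_scope.
Local Open Scope ereal_scope.

(** * Potentials of Radon measures *)

Section Borel_sets.
Context {X : ptopologicalType}.

Lemma open_borel (U : set X) : open U -> measurable (U : set (Borel X)).
Proof. by move=> oU; apply: sub_sigma_algebra. Qed.

Lemma closed_borel (F : set X) : closed F -> measurable (F : set (Borel X)).
Proof.
move=> cF; rewrite -[F]setCK; apply: measurableC; apply: open_borel.
exact: closed_openC.
Qed.

Lemma compact_borel (K : set X) : hausdorff_space X -> compact K ->
  measurable (K : set (Borel X)).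
Proof. by move=> hX /(compact_closed hX); exact: closed_borel. Qed.

Lemma lower_semicontinuous_borel {R : realType} (f : X -> \bar R) :
  lower_semicontinuous f -> measurable_fun [set: Borel X] f.
Proof.
move=> lf; apply: (measurability _ (ErealGenOInfty.measurableE R)).
move=> /= _ [_ [a ->]] <-; apply: measurableI => //; apply: open_borel.
by rewrite preimage_itvoy; move/lower_semicontinuousP : lf; exact.
Qed.

End Borel_sets.

Lemma lower_semicontinuous_section {R : realType} {X Y : topologicalType}
    (g : X * Y -> \bar R) (x : X) :
  lower_semicontinuous g -> lower_semicontinuous (fun y => g (x, y)).
Proof.
move=> lg y a agx; have [V [[P Q] /= [Px Qy] PQV] gV] := lg _ _ agx.
exists Q => // z Qz; apply: gV; apply: PQV; split => //=.
exact: nbhs_singleton Px.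
Qed.

(** Finite summands share the slack [v + w - b] equally; an infinite summand absorbs whatever is
    left. This lets lower bounds by reals pass to sums whose terms may be [+oo]. *)
Lemma lte_add_split {R : realFieldType} (v w : \bar R) (b : R) :
  0 <= v -> 0 <= w -> b%:E < v + w ->
  exists b1 b2 : R, [/\ b1%:E < v, b2%:E < w & b = (b1 + b2)%R].
Proof.
case: v w => [v| |] [w| |]//= v0 w0.
- rewrite -EFinD lte_fin => bvw.
  exists (v - (v + w - b) / 2)%R, (w - (v + w - b) / 2)%R.
  by rewrite !lte_fin; split; lra.
- by move=> _; exists (v - 1)%R, (b - v + 1)%R; rewrite ltry lte_fin; split=> //; lra.
- by move=> _; exists (b - w + 1)%R, (w - 1)%R; rewrite ltry lte_fin; split=> //; lra.
- by move=> _; exists b, 0%R; rewrite !ltry addr0.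
Qed.

(** Lower semicontinuity at [x] is the case [v = phi x]; a free [v] allows bounds coming from a
    simple function below the section at [x]. *)
Definition liminf_ge {R : realType} {X : topologicalType} (x : X)
    (phi : X -> \bar R) (v : \bar R) :=
  forall b : R, b%:E < v -> \forall y \near x, b%:E < phi y.

Lemma liminf_geD {R : realType} {X : topologicalType} (x : X)
    (phi psi : X -> \bar R) (v w : \bar R) : 0 <= v -> 0 <= w ->
  liminf_ge x phi v -> liminf_ge x psi w ->
  liminf_ge x (fun y => phi y + psi y) (v + w).
Proof.
move=> v0 w0 hv hw b /lte_add_split[//|//|b1 [b2 [h1 h2 ->]]].
by near do (rewrite EFinD; apply: lteD); [exact: hv|exact: hw].
Unshelve. all: by end_near. Qed.

Lemma liminf_ge_sum {R : realType} {X : topologicalType} (x : X) (J : eqType)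
    (s : seq J) (phi : J -> X -> \bar R) (v : J -> \bar R) :
  (forall j, 0 <= v j) -> (forall j, j \in s -> liminf_ge x (phi j) (v j)) ->
  liminf_ge x (fun y => (\sum_(j <- s) phi j y)%E) (\sum_(j <- s) v j)%E.
Proof.
move=> v0; elim: s => [|j s IH] h.
  by move=> b; rewrite big_nil => b0; apply: nearW => y; rewrite big_nil.
rewrite big_cons; under eq_fun do rewrite big_cons.
apply: liminf_geD => //; first exact: sume_ge0.
  by apply: h; rewrite mem_head.
by apply: IH => i si; apply: h; rewrite in_cons si orbT.
Qed.

(** A tube lemma: the strict inequality holds on a product neighbourhood of each [(x, y)], and
    compactness of [K] leaves one neighbourhood of [x] valid for all [y]. *)
Lemma compact_section_near {R : realType} {X Y : topologicalType}
    (g : X * Y -> \bar R) (x : X) (K : set Y) (a : R) :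
  lower_semicontinuous g -> compact K -> (forall y, K y -> a%:E < g (x, y)) ->
  \forall x' \near x, forall y, K y -> a%:E < g (x', y).
Proof.
move=> lg /compact_near_coveringP cK ag.
have := @cK X (nbhs x) (fun x' y => a%:E < g (x', y)) _ _; apply.
move=> y Ky; have [V [[P Q] /= [Px Qy] PQV] gV] := lg _ _ (ag _ Ky).
by exists (Q, P) => //= -[y' x'] /= [Qy' Px']; apply: gV; exact: PQV.
Qed.

Section potential.
Import HBNNSimple.
Context {R : realType} {X : ptopologicalType}.
Hypothesis hX : hausdorff_space X.
Variable g : X * X -> \bar R.
Hypothesis lg : lower_semicontinuous g.
Hypothesis g0 : forall z, 0 <= g z.

Let mg x : measurable_fun [set: Borel X] (fun y : Borel X => g (x, y)).
Proof.
apply: (@lower_semicontinuous_borel X R (fun y => g (x, y))).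
exact: lower_semicontinuous_section.
Qed.

Let mgB x (B : set (Borel X)) : measurable_fun B (fun y : Borel X => g (x, y)).
Proof. exact: measurable_funTS. Qed.

(** Inner regularity replaces [B] by a compact [K] of nearly the same mass, on which the tube lemma
    keeps neighbouring sections above a constant slightly smaller than [r]. *)
Lemma liminf_ge_integral (n : {measure set (Borel X) -> \bar R}) (x : X)
    (B : set (Borel X)) (r : R) :
  is_radon n -> measurable B -> (0 <= r)%R ->
  (forall y, B y -> r%:E <= g (x, y)) ->
  liminf_ge x (fun x' => \int[n]_(y in B) g (x', y)) (r%:E * n B).
Proof.
move=> [nfin nreg] mB; rewrite le_eqVlt => /predU1P[<- _ b|r0 rg b].
  rewrite mul0e => b0; apply: nearW => x'.
  by apply: lt_le_trans b0 _; apply: integral_ge0.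
have [b0 _|b0] := ltP b 0%R.
  apply: nearW => x'; apply: (@lt_le_trans _ _ 0); rewrite ?lte_fin//.
  exact: integral_ge0.
rewrite -lte_pdivrMl// -EFinM (nreg _ mB) => /ereal_sup_gt[_ [K [cK KB] <-]].
have mK : measurable (K : set (Borel X)) by exact: compact_borel.
have := nfin _ cK; have : 0 <= n K by [].
case E : (n K) => [c| |]//; rewrite lee_fin lte_fin => c0 _ bc.
have c1 : (0 < c)%R by apply: le_lt_trans bc; rewrite mulr_ge0// invr_ge0 ltW.
(* Being below [r] gives the strict inequality that the tube lemma asks for; being above [b / c]
   keeps [r' * n K] above [b]. *)
pose r' := ((r + b / c) / 2)%R.
have bcr : (b / c < r)%R by rewrite ltr_pdivrMr// -ltr_pdivrMl.
have r'r : (r' < r)%R by rewrite /r'; lra.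
have br' : (b < r' * c)%R by rewrite -ltr_pdivrMr// /r'; lra.
have := compact_section_near (x := x) (a := r') lg cK.
have : forall y, K y -> r'%:E < g (x, y).
  by move=> y /KB /rg; apply: lt_le_trans; rewrite lte_fin.
move=> /[swap] /[apply] near_g.
apply: filterS near_g => x' near_g.
apply: (@lt_le_trans _ _ (\int[n]_(y in K) cst r'%:E y)).
  by rewrite integral_cst// [n K]E -EFinM lte_fin.
apply: (@le_trans _ _ (\int[n]_(y in K) g (x', y))).
  apply: ge0_le_integral => // y Ky; last by rewrite ltW// near_g.
  by rewrite lee_fin /r' divr_ge0// addr_ge0// ?divr_ge0// ltW.
exact: ge0_subset_integral.
Qed.

(* Inner regularity replaces the joint measurability of [g], which may fail for
   the product of the Borel sigma-algebras: a simple function below a section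
   of [g] is carried by finitely many compact sets, and the tube lemma moves it
   to the neighbouring sections. *)
Lemma potential_lower_semicontinuous (n : {measure set (Borel X) -> \bar R}) :
  is_radon n -> lower_semicontinuous (fun x => \int[n]_y g (x, y)).
Proof.
move=> rn x a; rewrite ge0_integralTE// => /ereal_sup_gt[_ [h /= hg <-]].
rewrite sintegralE fsbig_finite /=; last exact: fimfunP.
move=> ah.
set s := finmap.enum_fset _ in ah.
have hs : forall r, r \in s -> (0 <= r)%R.
  move=> r; rewrite /s in_fset_set ?inE; last exact: fimfunP.
  by move=> [y _ <-]; exact: fun_ge0.
pose phi r x' := \int[n]_(y in h @^-1` [set r]) g (x', y).
have /(_ _ ah) : liminf_ge x (fun x' => (\sum_(r <- s) phi r x')%E)
    (\sum_(r <- s) (r%:E * n (h @^-1` [set r])))%E.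
  apply: (@liminf_ge_sum R X x R s phi) => [r|r rs].
    by rewrite nnsfun_mulemu_ge0.
  apply: liminf_ge_integral => //; first exact: hs.
  by move=> y /= <-; exact: hg.
move=> H; exists [set x' | a%:E < (\sum_(r <- s) phi r x')%E] => // x' /= ax'.
(* The level sets of [h] are disjoint, so the sum is a single integral over their union. *)
apply: (lt_le_trans ax'); rewrite /phi -ge0_integral_bigsetU//.
- apply: ge0_subset_integral => //; apply: bigsetU_measurable => //.
- exact: finmap.fset_uniq.
- exact: trivIset_preimage1.
Qed.

End potential.

(** * Radon measures: comparison on compact sets, sums, multiples, restrictions *)

Lemma lee_lt_real {R : realFieldType} (x y : \bar R) :
  (forall b : R, b%:E < x -> b%:E <= y) -> x <= y.
Proof.
case: x y => [x| |] [y| |]// h; rewrite ?leey ?leNye//.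
- rewrite lee_fin leNgt; apply/negP => yx.
  have := h ((x + y) / 2)%R; rewrite lte_fin lee_fin => h1.
  by have := h1 _; lra.
- by have := h (x - 1)%R; rewrite lte_fin ltrBlDr ltrDl ltr01 => /(_ isT).
- by have := h (y + 1)%R; rewrite ltry lee_fin gerDl ler10 => /(_ isT).
- by have := h 0%R; rewrite ltry => /(_ isT).
Qed.

Lemma add_measureE d (T : measurableType d) (R : realType)
    (p q : {measure set T -> \bar R}) (A : set T) :
  (measure_add p q : {measure set T -> \bar R}) A = p A + q A.
Proof. exact: measure_addE. Qed.

Section radon.
Context {R : realType} {X : ptopologicalType}.
Implicit Types m n p q : {measure set (Borel X) -> \bar R}.

Lemma radon_lt m (B : set (Borel X)) (b : R) :
  is_radon m -> measurable B -> b%:E < m B ->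
  exists K : set X, [/\ compact K, K `<=` B & b%:E < m K].
Proof.
by move=> [_ mreg] mB; rewrite (mreg _ mB) => /ereal_sup_gt[_ [K [cK KB] <-]]; exists K.
Qed.

Hypothesis hX : hausdorff_space X.

Lemma is_radonP m : is_radon m <->
  (forall K : set X, compact K -> m K < +oo) /\
  forall (B : set (Borel X)) (b : R), measurable B -> b%:E < m B ->
    exists K : set X, [/\ compact K, K `<=` B & b%:E < m K].
Proof.
split=> [rm|[mfin h]]; first by split=> [|B b]; [case: rm|exact: radon_lt].
split=> // B mB; apply/eqP; rewrite eq_le; apply/andP; split; last first.
  apply: ge_ereal_sup => _ [K [cK KB] <-]; apply: le_measure; rewrite ?inE//.
  exact: compact_borel.
apply: lee_lt_real => b /(h _ _ mB)[K [cK KB bK]].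
by apply: (le_trans (ltW bK)); apply: ereal_sup_ubound; exists K.
Qed.

Lemma radon_le p q : is_radon p ->
  (forall K : set X, compact K -> p K <= q K) ->
  forall B : set (Borel X), measurable B -> p B <= q B.
Proof.
move=> rp pq B mB; apply: lee_lt_real => b /(radon_lt rp mB)[K [cK KB bK]].
apply: (le_trans (ltW bK)); apply: (le_trans (pq _ cK)).
by apply: le_measure; rewrite ?inE//; exact: compact_borel.
Qed.

Lemma is_radon_add p q : is_radon p -> is_radon q -> is_radon (measure_add p q).
Proof.
move=> rp rq; apply/is_radonP; split=> [K cK|B b mB].
  by rewrite add_measureE lte_add_pinfty//; [case: rp|case: rq] => + _; exact.
rewrite add_measureE => /lte_add_split[//|//|b1 [b2 [h1 h2 ->]]].
have [K1 [cK1 K1B k1]] := radon_lt rp mB h1.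
have [K2 [cK2 K2B k2]] := radon_lt rq mB h2.
have cK : compact (K1 `|` K2) by exact: compactU.
exists (K1 `|` K2); split => //; first by rewrite subUset.
rewrite add_measureE EFinD; apply: lteD.
  by apply: (lt_le_trans k1); apply: le_measure; rewrite ?inE//; exact: compact_borel.
by apply: (lt_le_trans k2); apply: le_measure; rewrite ?inE//; exact: compact_borel.
Qed.

Lemma is_radon_mscale m (c : {nonneg R}) : is_radon m -> is_radon (mscale c m).
Proof.
move=> rm; apply/is_radonP; split=> [K cK|B b mB].
  by rewrite /= /mscale; apply: lte_mul_pinfty => //; case: rm => + _; exact.
rewrite /= /mscale.
have [->|c0] := eqVneq c%:num 0%R.
  by rewrite mul0e => b0; exists set0; rewrite mul0e; split => //; exact: compact0.
have {}c0 : (0 < c%:num)%R by rewrite lt_neqAle eq_sym c0/=.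
rewrite -lte_pdivrMl// -EFinM => /(radon_lt rm mB)[K [cK KB bK]].
by exists K; split => //; rewrite -lte_pdivrMl.
Qed.

Lemma is_radon_mzero : is_radon (@mzero _ (Borel X) R).
Proof.
apply/is_radonP; split=> [K cK|B b mB b0]; first by rewrite /= /mzero ltry.
by exists set0; split => //; exact: compact0.
Qed.

Lemma is_radon_mrestr m (D : set (Borel X)) (mD : measurable D) :
  is_radon m -> is_radon (mrestr m mD).
Proof.
move=> rm; apply/is_radonP; split=> [K cK|B b mB].
  rewrite /= /mrestr; have [mfin _] := rm; apply: le_lt_trans (mfin _ cK).
  by have := compact_borel hX cK => mK; apply: le_measure; rewrite ?inE//; exact: measurableI.
rewrite /= /mrestr => /(radon_lt rm (measurableI _ _ mB mD))[K [cK KBD bK]].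
by exists K; split=> //; [move=> x /KBD[]|rewrite setIidl// => x /KBD[]].
Qed.

End radon.

(** * Double integrals of kernels bounded below *)

(** The identity [(f + C) + f^- = f^+ + C] relates nonnegative functions, so it can be integrated
    term by term; [f^-] is at most [C], hence has a finite integral when the mass is finite, and can
    be cancelled. *)
Lemma integral_shift d (T : measurableType d) (R : realType)
    (m : {measure set T -> \bar R}) (f : T -> \bar R) (C : R) :
  measurable_fun [set: T] f -> (forall x, - C%:E <= f x) ->
  (0 <= C)%R -> C = 0%R \/ m [set: T] < +oo ->
  \int[m]_x f x = \int[m]_x (f x + C%:E) - C%:E * m [set: T].
Proof.
move=> mf fC C0 [C00|mT].
  by rewrite C00 mul0e sube0; apply: eq_integral => x _; rewrite adde0.
have mfin : m [set: T] \is a fin_num by rewrite ge0_fin_numE.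
have fn x : f^\- x <= C%:E.
  by rewrite funenegE ge_max lee_fin C0 andbT leeNl.
have mfp : measurable_fun [set: T] f^\+ by exact: measurable_funepos.
have mfn : measurable_fun [set: T] f^\- by exact: measurable_funeneg.
have mfC : measurable_fun [set: T] (fun x => f x + C%:E).
  by apply: emeasurable_funD.
have fnC : \int[m]_x f^\- x <= C%:E * m [set: T].
  rewrite -integral_cst//; apply: ge0_le_integral => //.
have fnfin : \int[m]_x f^\- x \is a fin_num.
  rewrite ge0_fin_numE; last by apply: integral_ge0.
  by apply: (le_lt_trans fnC); rewrite -ge0_fin_numE ?mule_ge0// fin_numM.
have : \int[m]_x (f x + C%:E) + \int[m]_x f^\- x =
       \int[m]_x f^\+ x + C%:E * m [set: T].
  rewrite -integral_cst// -!ge0_integralD//; last first.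
    by move=> x _; rewrite -leeBlDr// add0e fC.
  apply: eq_integral => x _; have := fC x; rewrite funeposE funenegE /cst.
  case: (f x) => [r| |]// _; rewrite /maxe ?ltNyr// ?addye//.
  rewrite -EFinN !lte_fin oppr_lt0; case: ltgtP => // [r0|r0|<-].
  - by rewrite adde0.
  - by rewrite -!EFinD; congr (_%:E); ring.
  - by rewrite oppr0 adde0.
rewrite [in X in _ -> X]integralE => h.
rewrite -[\int[m]_x (f x + C%:E)](addeK _ fnfin) h addeAC addeK//.
by rewrite fin_numM.
Qed.

(** If [X * X] is compact, so is its projection [X], and near every point some real bounds [k] from
    below; compactness, used with the filter of large constants, makes the bound uniform. Otherwise
    the kernel is nonnegative. *)
Lemma kernel_lower_bound {R : realType} {X : ptopologicalType}
    (k : X * X -> \bar R) : potential_kernel k ->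
  exists C : R, [/\ (0 <= C)%R, forall z, - C%:E <= k z &
                    C = 0%R \/ compact [set: X]].
Proof.
move=> [[lk kNy kge0] _].
have [cXX|/kge0 {}kge0] := pselect (compact [set: X * X]); last first.
  by exists 0%R; split=> //; [move=> z; rewrite oppe0|left].
have cX : compact [set: X].
  suff <- : fst @` [set: X * X] = [set: X].
    apply: continuous_compact => //; apply: continuous_subspaceT => x.
    exact: cvg_fst.
  by apply/seteqP; split=> // x _; exists (x, x).
move/compact_near_coveringP : cXX => cXX.
have /(_ _) H := @cXX R (pinfty_nbhs R) (fun C z => - C%:E <= k z) _ _.
have : \forall C \near pinfty_nbhs R, [set: X * X] `<=` (fun z => - C%:E <= k z).
  apply: H => z _.
  have [a az] : exists a : R, a%:E < k z.
    have := kNy z; case: (k z) => [r| |]// _; last by exists 0%R; rewrite ltry.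
    by exists (r - 1)%R; rewrite lte_fin; lra.
  have [V Vz Vk] := lk _ _ az.
  exists (V, [set C | - a <= C]%R) => /=.
    by split=> //; apply: nbhs_pinfty_ge; rewrite num_real.
  move=> -[z' C] /= [/Vk az' aC]; apply: le_trans (ltW az').
  by rewrite lee_fin lerNl.
move=> /(filterI (nbhs_pinfty_ge (num_real 0%R))) /filter_ex[C [C0 kC]].
by exists C; split=> //; [move=> z; exact: kC|right].
Qed.

Lemma eq_iint {R : realType} {X : ptopologicalType} (k : X * X -> \bar R)
    (m m' n n' : {measure set (Borel X) -> \bar R}) :
  (forall B, measurable B -> m B = m' B) -> (forall B, measurable B -> n B = n' B) ->
  iint k m n = iint k m' n'.
Proof.
move=> mm' nn'; rewrite /iint (eq_measure_integral m') => [|B mB _]; last exact: mm'.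
by apply: eq_integral => x _; apply: eq_measure_integral => B mB _; exact: nn'.
Qed.

Section nonnegative_kernel.
Context {R : realType} {X : ptopologicalType}.
Hypothesis hX : hausdorff_space X.
Variable g : X * X -> \bar R.
Hypothesis lg : lower_semicontinuous g.
Hypothesis g0 : forall z, 0 <= g z.
Implicit Types m n : {measure set (Borel X) -> \bar R}.

Lemma measurable_section x : measurable_fun [set: Borel X] (fun y : Borel X => g (x, y)).
Proof.
apply: (@lower_semicontinuous_borel X R (fun y => g (x, y))).
exact: lower_semicontinuous_section.
Qed.

Lemma measurable_potential n : is_radon n ->
  measurable_fun [set: Borel X] (fun x : Borel X => \int[n]_y g (x, y)).
Proof.
move=> rn; apply: (@lower_semicontinuous_borel X R (fun x => \int[n]_y g (x, y))).
exact: potential_lower_semicontinuous.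
Qed.

Lemma potential_ge0 n x : 0 <= \int[n]_y g (x, y).
Proof. exact: integral_ge0. Qed.

Lemma ge0_iint m n : 0 <= iint g m n.
Proof. by apply: integral_ge0 => x _; exact: potential_ge0. Qed.

Lemma ge0_iintDl m1 m2 n : is_radon n ->
  iint g (measure_add m1 m2) n = iint g m1 n + iint g m2 n.
Proof.
move=> rn; apply: ge0_integral_measure_add => //; last exact: measurable_potential.
by move=> x _; exact: potential_ge0.
Qed.

Lemma ge0_iintDr m n1 n2 : is_radon n1 -> is_radon n2 ->
  iint g m (measure_add n1 n2) = iint g m n1 + iint g m n2.
Proof.
move=> rn1 rn2; rewrite /iint -ge0_integralD//; last 4 first.
- by move=> x _; exact: potential_ge0.
- exact: measurable_potential.
- by move=> x _; exact: potential_ge0.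
- exact: measurable_potential.
apply: eq_integral => x _; apply: ge0_integral_measure_add => //.
exact: measurable_section.
Qed.

Lemma ge0_le_iint m1 m2 n1 n2 : is_radon n1 -> is_radon n2 ->
  (forall B, measurable B -> m1 B <= m2 B) -> (forall B, measurable B -> n1 B <= n2 B) ->
  iint g m1 n1 <= iint g m2 n2.
Proof.
move=> rn1 rn2 m12 n12; apply: (@le_trans _ _ (iint g m2 n1)).
  apply: ge0_le_measure_integral => [|//|x|]; first exact: m12.
    exact: potential_ge0.
  exact: measurable_potential.
apply: ge0_le_integral; first exact: measurableT.
- by move=> x _; exact: potential_ge0.
- exact: measurable_potential.
- exact: measurable_potential.
- move=> x _; apply: ge0_le_measure_integral => //.
  exact: measurable_section.
Qed.

Lemma ge0_iint_mscale (c : {nonneg R}) m n : is_radon n ->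
  iint g (mscale c m) (mscale c n) = c%:num%:E * (c%:num%:E * iint g m n).
Proof.
move=> rn; rewrite /iint -ge0_integralZl//; last 2 first.
- exact: measurable_potential.
- by move=> x _; exact: potential_ge0.
rewrite ge0_integral_mscale//; last 2 first.
- by apply: measurable_potential; exact: is_radon_mscale.
- by move=> x _; exact: potential_ge0.
congr (_ * _); apply: eq_integral => x _; rewrite ge0_integral_mscale//.
exact: measurable_section.
Qed.

End nonnegative_kernel.

Lemma lteB_fin {R : realDomainType} (a c : \bar R) :
  c \is a fin_num -> (a - c < +oo) = (a < +oo).
Proof. by case: a c => [a| |] [c| |]//= _; rewrite -EFinB !ltry. Qed.

Section kernel_form.
Context {R : realType} {X : ptopologicalType}.
Hypothesis hX : hausdorff_space X.
Variable k : X * X -> \bar R.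
Hypothesis kk : potential_kernel k.
Implicit Types m n p q : {measure set (Borel X) -> \bar R}.

(* On a compact space a kernel may be negative; it is then raised by a constant,
   which changes the double integrals by finite amounts. *)
Lemma iint_shift : exists (g : X * X -> \bar R) (C : R),
  [/\ lower_semicontinuous g, forall z, 0 <= g z, (0 <= C)%R &
   forall m n, is_radon m -> is_radon n ->
     C%:E * n [set: X] * m [set: X] \is a fin_num /\
     iint k m n = iint g m n - C%:E * n [set: X] * m [set: X]].
Proof.
have [C [C0 kC hC]] := kernel_lower_bound kk.
have [[lk kNy _] _] := kk.
pose g z := k z + C%:E.
have g0 z : 0 <= g z by rewrite /g -leeBlDr// add0e.
have lg : lower_semicontinuous g.
  move=> z a; rewrite /g -lteBlDr// -EFinB => /lk[V Vz Vk].
  by exists V => // z' /Vk; rewrite EFinB lteBlDr.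
exists g, C; split=> // m n rm rn.
have hfin p : is_radon p -> C = 0%R \/ p [set: X] < +oo.
  by move=> [pfin _]; case: hC => [|/pfin]; [left|right].
have Cfin p : is_radon p -> C%:E * p [set: X] \is a fin_num.
  move=> /hfin[->|pT]; first by rewrite mul0e.
  by rewrite fin_numM// ge0_fin_numE.
have c2 : C%:E * n [set: X] * m [set: X] \is a fin_num.
  have [C00|mT] := hfin _ rm; first by rewrite C00 !mul0e.
  by rewrite fin_numM ?Cfin// ge0_fin_numE.
split=> //.
have mk x : measurable_fun [set: Borel X] (fun y : Borel X => k (x, y)).
  exact: measurable_section.
have inner x : \int[n]_y k (x, y) = \int[n]_y g (x, y) - C%:E * n [set: X].
  by apply: integral_shift => //; exact: hfin.
have Cnfin := Cfin _ rn.
(* The inner integral lowers the potential by this constant, which is then the lower bound used to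
   shift the outer integral. *)
pose C2 := fine (C%:E * n [set: X]).
have C2E : C%:E * n [set: X] = C2%:E by rewrite fineK.
have C20 : (0 <= C2)%R by rewrite fine_ge0// mule_ge0.
have mg : measurable_fun [set: Borel X] (fun x : Borel X => \int[n]_y g (x, y)).
  exact: measurable_potential.
rewrite /iint (@integral_shift _ _ _ m _ C2)//.
- rewrite C2E; congr (_ - _); apply: eq_integral => x _.
  by rewrite inner C2E subeK.
- under eq_fun do rewrite inner C2E.
  by apply: emeasurable_funB.
- move=> x; rewrite inner C2E leeBrDr// addeC subee//.
  exact: potential_ge0.
- have [C00|mT] := hfin _ rm; last by right.
  by left; rewrite /C2 C00 mul0e.
Qed.

Lemma iint_gtNy m n : is_radon m -> is_radon n -> -oo < iint k m n.
Proof.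
have [g [C [lg g0 C0 h]]] := iint_shift => rm rn; have [cfin ->] := h _ _ rm rn.
by rewrite lteBrDr// addNye; apply: lt_le_trans (ge0_iint g0 m n).
Qed.

Lemma iintDl m1 m2 n : is_radon m1 -> is_radon m2 -> is_radon n ->
  iint k (measure_add m1 m2) n = iint k m1 n + iint k m2 n.
Proof.
have [g [C [lg g0 C0 h]]] := iint_shift => r1 r2 rn.
have r12 := is_radon_add hX r1 r2.
have [_ ->] := h _ _ r12 rn; have [c1 ->] := h _ _ r1 rn; have [c2 ->] := h _ _ r2 rn.
rewrite ge0_iintDl// add_measureE ge0_muleDr// fin_num_oppeD// addeACA//.
Qed.

Lemma iintDr m n1 n2 : is_radon m -> is_radon n1 -> is_radon n2 ->
  iint k m (measure_add n1 n2) = iint k m n1 + iint k m n2.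
Proof.
have [g [C [lg g0 C0 h]]] := iint_shift => rm r1 r2.
have r12 := is_radon_add hX r1 r2.
have [_ ->] := h _ _ rm r12; have [c1 ->] := h _ _ rm r1; have [c2 ->] := h _ _ rm r2.
rewrite ge0_iintDr// add_measureE ge0_muleDr// ge0_muleDl ?mule_ge0//.
by rewrite fin_num_oppeD// addeACA.
Qed.

(** For a kernel of varying sign the double integral is not monotone in the measures. It is for the
    raised kernel, and the two differ by finite amounts, so finiteness is inherited. *)
Lemma le_iint_lty m1 m2 n1 n2 :
  is_radon m1 -> is_radon m2 -> is_radon n1 -> is_radon n2 ->
  (forall B, measurable B -> m1 B <= m2 B) -> (forall B, measurable B -> n1 B <= n2 B) ->
  iint k m2 n2 < +oo -> iint k m1 n1 < +oo.
Proof.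
have [g [C [lg g0 C0 h]]] := iint_shift => rm1 rm2 rn1 rn2 m12 n12.
have [c1 ->] := h _ _ rm1 rn1; have [c2 ->] := h _ _ rm2 rn2.
rewrite (lteB_fin _ c1) (lteB_fin _ c2) => h2; apply: le_lt_trans h2.
exact: (ge0_le_iint hX lg g0 rn1 rn2 m12 n12).
Qed.

Lemma iint_mscale_lty (c : {nonneg R}) m : is_radon m -> iint k m m < +oo ->
  iint k (mscale c m) (mscale c m) < +oo.
Proof.
have [g [C [lg g0 C0 h]]] := iint_shift => rm.
have [c1 ->] := h _ _ rm rm; have [c2 ->] := h _ _ (is_radon_mscale hX c rm) (is_radon_mscale hX c rm).
rewrite (lteB_fin _ c1) (lteB_fin _ c2) ge0_iint_mscale// => gfin.
by rewrite !lte_mul_pinfty// mule_ge0// ge0_iint.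
Qed.

End kernel_form.

(** * The positive and negative parts of a signed Radon measure *)

Section bounded_borel_sets.
Context {X : ptopologicalType}.

Lemma sub_bounded_borel (B C : set (Borel X)) :
  bounded_borel B -> measurable C -> C `<=` B -> bounded_borel C.
Proof. by move=> [mB [K cK BK]] mC CB; split=> //; exists K => // x /CB/BK. Qed.

Lemma bounded_borelU (B C : set X) :
  bounded_borel B -> bounded_borel C -> bounded_borel (B `|` C).
Proof.
move=> [mB [K cK BK]] [mC [L cL CL]]; split; first exact: measurableU.
by exists (K `|` L); [exact: compactU|exact: setUSS].
Qed.

Lemma bounded_borel0 : bounded_borel (set0 : set X).
Proof. by split; [exact: measurable0|exists set0 => //; exact: compact0]. Qed.

Lemma compact_bounded_borel (K : set X) :
  hausdorff_space X -> compact K -> bounded_borel K.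
Proof. by move=> hX cK; split; [exact: compact_borel|exists K]. Qed.

End bounded_borel_sets.

(** The pair is any representation of [mu], not only the minimal one. *)
Definition radon_diff {R : realType} {X : ptopologicalType} (mu : set X -> R)
    (p q : {measure set (Borel X) -> \bar R}) :=
  [/\ is_radon p, is_radon q & forall B, bounded_borel B -> (mu B)%:E = p B - q B].

Section radon_parts.
Context {R : realType} {X : ptopologicalType}.
Hypothesis hX : hausdorff_space X.
Implicit Types (mu : set X -> R) (p q : {measure set (Borel X) -> \bar R}).

Lemma radon_fin_num p (B : set X) : is_radon p -> bounded_borel B -> p B \is a fin_num.
Proof.
move=> [pfin _] [mB [K cK BK]]; rewrite ge0_fin_numE//.
by apply: le_lt_trans (pfin _ cK); apply: le_measure; rewrite ?inE//; exact: compact_borel.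
Qed.

Lemma radon_diffN mu p q : radon_diff mu p q -> radon_diff (fun B => - mu B)%R q p.
Proof.
move=> [rp rq h]; split=> // B bB.
by rewrite EFinN h// fin_num_oppeB ?radon_fin_num// addeC.
Qed.

Lemma radon_diffE mu p q (B : set X) : radon_diff mu p q -> bounded_borel B ->
  p B = (mu B)%:E + q B.
Proof. by move=> [rp rq h] bB; rewrite h// subeK// radon_fin_num. Qed.

Lemma radon_diffD mu p q (B C : set X) : radon_diff mu p q ->
  bounded_borel B -> bounded_borel C -> B `&` C = set0 ->
  mu (B `|` C) = (mu B + mu C)%R.
Proof.
move=> d bB bC BC; have [rp rq h] := d.
have [mB _] := bB; have [mC _] := bC.
apply: EFin_inj; rewrite EFinD !h//; last exact: bounded_borelU.
rewrite !measureU// fin_num_oppeD ?radon_fin_num//.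
by rewrite addeACA.
Qed.

Lemma le_pospart mu (B C : set X) : bounded_borel C -> C `<=` B ->
  (mu C)%:E <= pospart mu B.
Proof. by move=> bC CB; apply: ereal_sup_ubound; exists C. Qed.

Lemma pospart_lt mu (B : set X) (b : R) : b%:E < pospart mu B ->
  exists C, [/\ bounded_borel C, C `<=` B & (b < mu C)%R].
Proof.
by move=> /ereal_sup_gt[_ [C [bC CB] <-]]; rewrite lte_fin => bmu; exists C.
Qed.

Lemma pospart_le mu (B : set X) (y : \bar R) :
  (forall C, bounded_borel C -> C `<=` B -> (mu C)%:E <= y) -> pospart mu B <= y.
Proof. by move=> h; apply: ge_ereal_sup => _ [C [bC CB] <-]; exact: h. Qed.

Lemma pospart_mono mu (B C : set X) : B `<=` C -> pospart mu B <= pospart mu C.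
Proof. by move=> BC; apply: pospart_le => D bD DB; apply: le_pospart => // x /DB/BC. Qed.

Lemma pospart_le_radon mu p q (B : set (Borel X)) : radon_diff mu p q ->
  measurable B -> pospart mu B <= p B.
Proof.
move=> d mB; apply: pospart_le => C bC CB; have [mC _] := bC.
apply: (@le_trans _ _ (p C)); last by apply: le_measure; rewrite ?inE.
by rewrite (radon_diffE d bC) leeDl.
Qed.

Lemma radon_diff_set0 mu p q : radon_diff mu p q -> mu set0 = 0%R.
Proof.
move=> [rp rq h]; apply: EFin_inj; rewrite h; last exact: bounded_borel0.
by rewrite !measure0 sube0.
Qed.

Lemma pospart_ge0 mu p q (B : set X) : radon_diff mu p q -> 0 <= pospart mu B.
Proof.
move=> d; have <- : (mu set0)%:E = 0 by rewrite (radon_diff_set0 d).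
exact: le_pospart bounded_borel0 _.
Qed.

Lemma pospart_set0 mu p q : radon_diff mu p q -> pospart mu set0 = 0.
Proof.
move=> d; apply/eqP; rewrite eq_le (pospart_ge0 _ d) andbT.
by apply: pospart_le => C _; rewrite subset0 => ->; rewrite (radon_diff_set0 d).
Qed.

Lemma pospart_superadditive mu p q (A B : set X) : radon_diff mu p q ->
  A `&` B = set0 -> pospart mu A + pospart mu B <= pospart mu (A `|` B).
Proof.
move=> d AB; apply: lee_lt_real => b.
move=> /lte_add_split[||b1 [b2 [h1 h2 ->]]]; [exact: pospart_ge0 d|exact: pospart_ge0 d|].
have [C [bC CA muC]] := pospart_lt h1; have [D [bD DB muD]] := pospart_lt h2.
apply: (@le_trans _ _ (mu (C `|` D))%:E).
  rewrite (radon_diffD d)// ?lee_fin ?lerD ?ltW//.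
  by apply/seteqP; split => // x [/CA Ax /DB Bx]; rewrite -AB.
by apply: le_pospart; [exact: bounded_borelU|exact: setUSS].
Qed.

(** Finite superadditivity gives one inequality in the limit. For the other, a bounded set inside
    the union is cut along the [F i]. *)
Lemma pospart_sigma_additive mu p q : radon_diff mu p q ->
  semi_sigma_additive (pospart mu : set (Borel X) -> \bar R).
Proof.
move=> d F mF tF mUF.
have F0 i : 0 <= pospart mu (F i) by exact: pospart_ge0 d.
rewrite -(_ : \sum_(0 <= i <oo) pospart mu (F i) = pospart mu (\bigcup_n F n)).
  exact: is_cvg_nneseries.
apply/eqP; rewrite eq_le; apply/andP; split.
  apply: lime_le; first exact: is_cvg_nneseries.
  apply: nearW => n; apply: (@le_trans _ _ (pospart mu (\big[setU/set0]_(i < n) F i))).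
    elim: n => [|n IH].
      by rewrite big_geq// big_ord0 (pospart_set0 d).
    rewrite big_nat_recr//= big_ord_recr/=; apply: (le_trans (leeD2r _ IH)).
    apply: (pospart_superadditive d).
    apply: (@trivIset_bigsetUI _ xpredT F _ n n) => //.
    by move=> i j _ _; exact: tF.
  by apply: pospart_mono; exact: bigsetU_bigcup.
apply: pospart_le => C bC CF; have [mC _] := bC; have [rp rq _] := d.
have mCF i : measurable (C `&` F i : set (Borel X)) by exact: measurableI.
have bCF i : bounded_borel (C `&` F i) by apply: (sub_bounded_borel bC).
have tCF : trivIset setT (fun i => C `&` F i) by exact: trivIset_setIl.
have CE : C = \bigcup_i (C `&` F i) by rewrite -setI_bigcupr setIidl.
have sumE (m : {measure set (Borel X) -> \bar R}) :
    m C = \sum_(0 <= i <oo) m (C `&` F i).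
  by rewrite {1}CE measure_semi_bigcup// -CE.
(* Adding the finite value [q C] to both sides leaves only series of nonnegative terms to
   compare. *)
rewrite -(@leeD2rE _ (q C)) ?(radon_fin_num rq)// -(radon_diffE d bC).
rewrite (sumE p) (sumE q) -nneseriesD//.
apply: lee_nneseries => // i _.
by rewrite (radon_diffE d (bCF i)) leeD2r// le_pospart.
Qed.

(** The proof of [radonM mu] is an argument so that a measure structure can be attached to this
    function. *)
Definition pospart_measure mu of radonM mu := pospart mu : set (Borel X) -> \bar R.

Section pospart_measure.
Variables (mu : set X -> R) (rmu : radonM mu).

Let diff : exists p q, radon_diff mu p q.
Proof. by have [p [q [rp rq h _]]] := rmu; exists p, q. Qed.

Let mu0 : pospart_measure rmu set0 = 0.
Proof. by have [p [q d]] := diff; exact: pospart_set0 d. Qed.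

Let mu_ge0 B : 0 <= pospart_measure rmu B.
Proof. by have [p [q d]] := diff; exact: pospart_ge0 d. Qed.

Let mu_add : semi_sigma_additive (pospart_measure rmu).
Proof. by have [p [q d]] := diff; exact: pospart_sigma_additive d. Qed.

HB.instance Definition _ := isMeasure.Build _ _ _ (pospart_measure rmu) mu0 mu_ge0 mu_add.

End pospart_measure.

(** If [mu C] exceeds [b], then [p C] exceeds [b + q C], and so does [p K] for some compact [K] in
    [C]; since [q K <= q C], also [mu K] exceeds [b]. *)
Lemma is_radon_pospart mu (rmu : radonM mu) : is_radon (pospart_measure rmu).
Proof.
have [p [q [rp rq h _]]] := rmu; have d : radon_diff mu p q by [].
apply/is_radonP => //; split=> [K cK|B b mB].
  apply: (le_lt_trans (pospart_le_radon d (compact_borel hX cK))).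
  by have [+ _] := rp; exact.
move=> /pospart_lt[C [bC CB bmu]]; have [mC _] := bC.
have : (b + fine (q C))%:E < p C.
  rewrite (radon_diffE d bC) -[q C]fineK ?(radon_fin_num rq)//=.
  by rewrite -EFinD lte_fin ltrD2r.
move=> /(radon_lt rp mC)[K [cK KC bK]].
have mK := compact_borel hX cK; have bbK := compact_bounded_borel hX cK.
exists K; split => //; first exact: subset_trans CB.
apply: lt_le_trans (le_pospart _ bbK (@subset_refl _ K)).
have : q K <= q C by apply: le_measure; rewrite ?inE.
move: bK; rewrite (radon_diffE d bbK) -[q C]fineK ?(radon_fin_num rq)//.
rewrite -[q K]fineK ?(radon_fin_num rq)// -EFinD !lte_fin lee_fin; lra.
Qed.

Lemma radonMN mu : radonM mu -> radonM (fun B => - mu B)%R.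
Proof.
move=> [p [q [rp rq h h0]]]; have [? ? ?] : radon_diff (fun B => - mu B)%R q p.
  exact: radon_diffN.
by exists q, p; split=> // B /h0 ->; rewrite oppr0.
Qed.

(** For [C] inside [B], the value [mu C] is [mu B] minus the value on the rest of [B]. Applied to
    [mu] and to its opposite, this yields the Jordan decomposition without a Hahn decomposition. *)
Lemma pospart_le_negpart mu p q (B : set X) : radon_diff mu p q -> bounded_borel B ->
  pospart mu B <= (mu B)%:E + pospart (fun C => - mu C)%R B.
Proof.
move=> d bB; have [mB _] := bB; apply: pospart_le => C bC CB; have [mC _] := bC.
have bD : bounded_borel (B `\` C).
  by apply: (sub_bounded_borel bB) => //; exact: measurableD.
have -> : mu B = (mu C + mu (B `\` C))%R.
  rewrite -(radon_diffD d)//; first by rewrite setDUK.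
  by apply/seteqP; split => // x [? []].
have := le_pospart (fun C => - mu C)%R bD (@subDsetl _ B C).
move=> /(leeD2l (mu C + mu (B `\` C))%:E); apply: le_trans.
by rewrite -EFinD addrK.
Qed.

Lemma radon_diff_parts mu (rmu : radonM mu) :
  radon_diff mu (pospart_measure rmu) (pospart_measure (radonMN rmu)).
Proof.
split; [exact: is_radon_pospart|exact: is_radon_pospart|move=> B bB].
have [p [q [rp rq h _]]] := rmu; have d : radon_diff mu p q by [].
suff : (mu B)%:E = pospart mu B - pospart (fun C => - mu C)%R B by [].
have hN : pospart (fun C => - mu C)%R B \is a fin_num.
  exact: (radon_fin_num (is_radon_pospart (radonMN rmu)) bB).
have hP : pospart mu B \is a fin_num.
  exact: (radon_fin_num (is_radon_pospart rmu) bB).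
have := pospart_le_negpart d bB.
have := pospart_le_negpart (radon_diffN d) bB.
rewrite (_ : (fun C => - - mu C)%R = mu); last by apply/funext => C; rewrite opprK.
rewrite -(fineK hP) -(fineK hN) -EFinB -!EFinD !lee_fin => h1 h2.
congr (_%:E); lra.
Qed.

Lemma radon_parts mu : radonM mu ->
  exists P N : {measure set (Borel X) -> \bar R},
    [/\ radon_diff mu P N, (P : set (Borel X) -> \bar R) = pospart mu &
        (N : set (Borel X) -> \bar R) = negpart mu].
Proof.
move=> rmu; exists (pospart_measure rmu), (pospart_measure (radonMN rmu)).
by split=> //; exact: radon_diff_parts.
Qed.

(** Crossed sums avoid [+oo - +oo] on unbounded sets. They agree on compact sets, where all values
    are finite, and inner regularity extends this to Borel sets. *)
Lemma radon_diff_eq mu p q p' q' : radon_diff mu p q -> radon_diff mu p' q' ->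
  forall B : set (Borel X), measurable B ->
    p B + q' B = p' B + q B.
Proof.
move=> d d' B mB; have [rp rq _] := d; have [rp' rq' _] := d'.
have E (K : set X) : compact K -> measure_add p q' K = measure_add p' q K.
  move=> cK; have bK := compact_bounded_borel hX cK.
  by rewrite !measure_addE (radon_diffE d bK) (radon_diffE d' bK) addeAC.
rewrite -!measure_addE; apply/eqP; rewrite eq_le; apply/andP; split.
  apply: (@radon_le _ _ hX (measure_add p q') (measure_add p' q)) => //.
    exact: is_radon_add.
  by move=> K cK; rewrite le_eqVlt; apply/orP; left; apply/eqP; exact: E.
apply: (@radon_le _ _ hX (measure_add p' q) (measure_add p q')) => //.
  exact: is_radon_add.
by move=> K cK; rewrite le_eqVlt; apply/orP; left; apply/eqP; apply/esym; exact: E.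
Qed.

Definition radon_sub p q (B : set X) : R :=
  if `[<bounded_borel B>] then (fine (p B) - fine (q B))%R else 0%R.

Lemma radon_diff_sub p q : is_radon p -> is_radon q -> radon_diff (radon_sub p q) p q.
Proof.
move=> rp rq; split=> // B bB; rewrite /radon_sub asboolT// EFinB.
by rewrite !fineK// radon_fin_num.
Qed.

Lemma radonM_sub p q : is_radon p -> is_radon q -> radonM (radon_sub p q).
Proof.
move=> rp rq; have [? ? ?] := radon_diff_sub rp rq.
by exists p, q; split => // B bB; rewrite /radon_sub asboolF.
Qed.

Lemma pospart_radon_sub0 p (B : set (Borel X)) : is_radon p -> measurable B ->
  pospart (radon_sub p mzero) B = p B.
Proof.
move=> rp mB; have d := radon_diff_sub rp (is_radon_mzero hX).
apply/eqP; rewrite eq_le (pospart_le_radon d mB)/=.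
apply: lee_lt_real => b /(radon_lt rp mB)[K [cK KB bK]].
have bbK := compact_bounded_borel hX cK.
apply: (le_trans (ltW bK)); apply: le_trans (le_pospart _ bbK KB).
by rewrite (radon_diffE d bbK) /= /mzero adde0.
Qed.

End radon_parts.

(** * Biadditive forms *)

(** A discriminant bound with natural coefficients. With [d = c - 2 * u * v] the form is
    [(a * u - b * v) ^+ 2 - a * b * d]; taking [a] near [n * v] and [b] near [n * u] keeps the
    square bounded while [a * b] grows with [n]. *)
Lemma natural_form_bound {R : realType} (u v c : R) : (0 <= u)%R -> (0 <= v)%R ->
  (forall a b : nat,
    0 <= a%:R ^+ 2 * u ^+ 2 - a%:R * b%:R * c + b%:R ^+ 2 * v ^+ 2)%R ->
  (c <= 2 * u * v)%R.
Proof.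
move=> u0 v0 h; rewrite leNgt; apply/negP => uvc.
have c0 : (0 < c)%R by apply: le_lt_trans uvc; rewrite !mulr_ge0.
(* For [u = 0] and [b = 1] the form is [v ^+ 2 - a * c], negative once [a] exceeds [v ^+ 2 / c]; the
   case [v = 0] is symmetric. *)
have [u00|un0] := eqVneq u 0%R.
  have := h (Num.truncn (v ^+ 2 / c)).+1 1%N.
  have := truncnS_gt (v ^+ 2 / c); rewrite ltr_pdivrMr// u00; nra.
have [v00|vn0] := eqVneq v 0%R.
  have := h 1%N (Num.truncn (u ^+ 2 / c)).+1.
  have := truncnS_gt (u ^+ 2 / c); rewrite ltr_pdivrMr// v00; nra.
have {}u0 : (0 < u)%R by rewrite lt_neqAle eq_sym un0.
have {}v0 : (0 < v)%R by rewrite lt_neqAle eq_sym vn0.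
pose d := (c - 2 * u * v)%R; have d0 : (0 < d)%R by rewrite subr_gt0.
(* Chosen so that [n * (u * v * d)] exceeds [(u + v) ^+ 2], the bound for the square; [n >= 1] makes
   [n ^+ 2] at least as good. *)
pose n : R := (Num.truncn ((u + v) ^+ 2 / (u * v * d))).+1%:R.
have n1 : (1 <= n)%R by rewrite ler1n.
have uvd0 : (0 < u * v * d)%R by rewrite !mulr_gt0.
have nlt : ((u + v) ^+ 2 < n * (u * v * d))%R.
  by rewrite -ltr_pdivrMr// truncnS_gt.
pose a : R := (Num.truncn (n * v)).+1%:R; pose b : R := (Num.truncn (n * u)).+1%:R.
have n0 : (0 <= n)%R by apply: le_trans n1.
have a1 : (n * v < a)%R := truncnS_gt _.
have b1 : (n * u < b)%R := truncnS_gt _.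
have a2 : (a <= n * v + 1)%R by rewrite /a -natr1 lerD2r truncn_le// mulr_ge0// ltW.
have b2 : (b <= n * u + 1)%R by rewrite /b -natr1 lerD2r truncn_le// mulr_ge0// ltW.
have := h (Num.truncn (n * v)).+1 (Num.truncn (n * u)).+1; rewrite -/a -/b.
have -> : (a ^+ 2 * u ^+ 2 - a * b * c + b ^+ 2 * v ^+ 2 =
           (a * u - b * v) ^+ 2 - a * b * d)%R by rewrite /d; ring.
apply/negP; rewrite -ltNge subr_lt0.
(* The multiples of [n] cancel, and each rounding error is at most 1. *)
have abs : (`|a * u - b * v| <= u + v)%R by rewrite ler_norml; apply/andP; split; nra.
apply: (@le_lt_trans _ _ ((u + v) ^+ 2)%R).
  by rewrite -real_normK ?num_real// lerXn2r// ?nnegrE// addr_ge0// ltW.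
apply: (lt_le_trans nlt).
have nn : (n * (u * v) <= (n * v) * (n * u))%R.
  rewrite mulrACA (mulrC v u); apply: ler_wpM2r; last exact: ler_peMl.
  by apply: mulr_ge0; exact: ltW.
have ab : ((n * v) * (n * u) <= a * b)%R.
  by apply: ler_pM; rewrite ?mulr_ge0// ltW.
rewrite [X in (X <= _)%R]mulrA ler_wpM2r ?(ltW d0)//.
exact: le_trans nn ab.
Qed.

Section biadditive_form.
Local Open Scope ring_scope.
Context {R : realType} {V : zmodType}.
Variables (S : set V) (B : V -> V -> R).
Hypothesis S0 : S 0.
Hypothesis SN : forall x, S x -> S (- x).
Hypothesis SD : forall x y, S x -> S y -> S (x + y).
Hypothesis BDl : forall x y z, S x -> S y -> S z -> B (x + y) z = B x z + B y z.
Hypothesis BDr : forall x y z, S x -> S y -> S z -> B x (y + z) = B x y + B x z.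
Hypothesis B0 : forall x, S x -> 0 <= B x x.

Lemma biadd0l x : S x -> B 0 x = 0.
Proof. by move=> Sx; have := BDl S0 S0 Sx; rewrite addr0; lra. Qed.

Lemma biadd0r x : S x -> B x 0 = 0.
Proof. by move=> Sx; have := BDr Sx S0 S0; rewrite addr0; lra. Qed.

Lemma biaddNl x y : S x -> S y -> B (- x) y = - B x y.
Proof.
by move=> Sx Sy; have := BDl Sx (SN Sx) Sy; rewrite subrr biadd0l//; lra.
Qed.

Lemma biaddNr x y : S x -> S y -> B x (- y) = - B x y.
Proof.
by move=> Sx Sy; have := BDr Sx Sy (SN Sy); rewrite subrr biadd0r//; lra.
Qed.

Lemma biadd_sum_closed (J : Type) (r : seq J) (f : J -> V) :
  (forall j, S (f j)) -> S (\sum_(j <- r) f j).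
Proof. by move=> Sf; elim/big_ind : _. Qed.

Lemma biadd_suml (J : Type) (r : seq J) (f : J -> V) y :
  (forall j, S (f j)) -> S y -> B (\sum_(j <- r) f j) y = \sum_(j <- r) B (f j) y.
Proof.
move=> Sf Sy; elim: r => [|j r IH]; first by rewrite !big_nil biadd0l.
by rewrite !big_cons BDl ?IH//; exact: biadd_sum_closed.
Qed.

Lemma biadd_sumr (J : Type) (r : seq J) (f : J -> V) x :
  S x -> (forall j, S (f j)) -> B x (\sum_(j <- r) f j) = \sum_(j <- r) B x (f j).
Proof.
move=> Sx Sf; elim: r => [|j r IH]; first by rewrite !big_nil biadd0r.
by rewrite !big_cons BDr ?IH//; exact: biadd_sum_closed.
Qed.

Lemma biadd_mulrn_closed x n : S x -> S (x *+ n).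
Proof. by move=> Sx; elim: n => [|n IH]; rewrite ?mulr0n// mulrS; exact: SD. Qed.

Lemma biadd_mulrnl x y n : S x -> S y -> B (x *+ n) y = n%:R * B x y.
Proof.
move=> Sx Sy; elim: n => [|n IH]; first by rewrite mulr0n biadd0l// mul0r.
by rewrite mulrS BDl ?IH// -?natr1; [ring|exact: biadd_mulrn_closed].
Qed.

Lemma biadd_mulrnr x y n : S x -> S y -> B x (y *+ n) = n%:R * B x y.
Proof.
move=> Sx Sy; elim: n => [|n IH]; first by rewrite mulr0n biadd0r// mul0r.
by rewrite mulrS BDr ?IH// -?natr1; [ring|exact: biadd_mulrn_closed].
Qed.

Lemma biadd_oppr_diag x : S x -> B (- x) (- x) = B x x.
Proof. by move=> Sx; rewrite biaddNl ?biaddNr ?opprK//; exact: SN. Qed.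

(* Only integral combinations are needed, and no symmetry of [B]: positivity on
   [a x - b y] bounds the sum [B x y + B y x]. *)
Lemma biadd_triangle x y : S x -> S y ->
  Num.sqrt (B (x + y) (x + y)) <= Num.sqrt (B x x) + Num.sqrt (B y y).
Proof.
move=> Sx Sy.
have xy : B x y + B y x <= 2 * Num.sqrt (B x x) * Num.sqrt (B y y).
  apply: natural_form_bound; rewrite ?sqrtr_ge0// => a b.
  rewrite !sqr_sqrtr ?B0//.
  have Sa := biadd_mulrn_closed a Sx; have Sb := biadd_mulrn_closed b Sy.
  have Sab := SD Sa (SN Sb).
  have := B0 Sab.
  rewrite BDl ?BDr ?biaddNl ?biaddNr ?biadd_mulrnl ?biadd_mulrnr//;
    try exact: SN.
  congr (0 <= _); ring.
rewrite -[leRHS]ger0_norm ?addr_ge0 ?sqrtr_ge0// -sqrtr_sqr ler_sqrt ?sqr_ge0//.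
rewrite BDl ?BDr//; last exact: SD.
by rewrite sqrrD !sqr_sqrtr ?B0//; lra.
Qed.

End biadditive_form.

(** * The energy form *)

Section energy.
Context {R : realType} {X : ptopologicalType}.
Hypothesis hX : hausdorff_space X.
Variable k : X * X -> \bar R.
Hypothesis kk : potential_kernel k.
Hypothesis spdk : strictly_positive_definite k.
Implicit Types (mu nu : set X -> R) (m n p q : {measure set (Borel X) -> \bar R}).

Definition finite_energy_radon p := is_radon p /\ iint k p p < +oo.

(* Positive definiteness applied to [p - q] bounds the mutual energy of its two
   parts [P] and [N]; since [p + N = P + q], this bounds the one of [p] and [q]. *)
Lemma mutual_fin_num p q : finite_energy_radon p -> finite_energy_radon q ->
  iint k p q \is a fin_num.
Proof.
move=> [rp pp] [rq qq]; rewrite fin_numE -ltNye (iint_gtNy hX kk rp rq)/= -ltey.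
have rmu := radonM_sub hX rp rq; have d := radon_diff_sub hX rp rq.
set mu := radon_sub p q in rmu d.
have [P [N [d' EP EN]]] := radon_parts hX rmu; have [rP rN _] := d'.
have Pp B : measurable B -> P B <= p B by rewrite EP; exact: pospart_le_radon d.
have Nq B : measurable B -> N B <= q B.
  by rewrite EN; exact: pospart_le_radon (radon_diffN hX d).
have pN_Pq := radon_diff_eq hX d d'.
have PP : iint k P P < +oo by exact: (le_iint_lty hX kk rP rp rP rp).
have NN : iint k N N < +oo by exact: (le_iint_lty hX kk rN rq rN rq).
have Pp' : iint k P p < +oo by apply: (le_iint_lty hX kk rP rp rp rp).
(* The energies of [P] and [N] are finite, so the energy of [mu] is defined; an infinite mutual
   energy would make it [-oo]. *)
have PN : iint k P N < +oo.
  have fPN : iint k P P + iint k N N \is a fin_num.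
    by rewrite fin_numD !fin_numElt !PP !NN !(iint_gtNy hX kk).
  have [] := spdk rmu; rewrite /energy/mutual_energy /mutual_energy_defined -EP -EN.
    by left.
  move=> + _; rewrite ltNge leye_eq; apply: contraTN => /eqP ->.
  rewrite addye; last by rewrite -ltNye (iint_gtNy hX kk).
  by rewrite addeNy.
(* First [q <= P + q = p + N] is used in the second argument, then [p <= p + N = P + q] in the
   first. *)
have Pq : iint k P q < +oo.
  apply: (@le_iint_lty _ _ hX _ kk P P q (measure_add p N)) => //.
  - exact: is_radon_add.
  - by move=> B mB; rewrite add_measureE pN_Pq// leeDr.
  by rewrite iintDr// lte_add_pinfty.
have : iint k (measure_add p N) q < +oo.
  rewrite (@eq_iint _ _ k (measure_add p N) (measure_add P q) q q)//; last first.
    by move=> B mB; rewrite !add_measureE pN_Pq.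
  by rewrite iintDl// lte_add_pinfty.
apply: (@le_iint_lty _ _ hX _ kk) => //; first exact: is_radon_add.
by move=> B mB; rewrite add_measureE leeDl.
Qed.

Definition joint p q : R := fine (iint k p q).

Lemma jointE p q : finite_energy_radon p -> finite_energy_radon q ->
  iint k p q = (joint p q)%:E.
Proof. by move=> fp fq; rewrite /joint fineK//; exact: mutual_fin_num. Qed.

Lemma jointDl p q n : finite_energy_radon p -> finite_energy_radon q ->
  finite_energy_radon n -> iint k (measure_add p q) n = (joint p n + joint q n)%:E.
Proof.
move=> fp fq fn; rewrite (iintDl hX kk fp.1 fq.1 fn.1).
by rewrite (jointE fp fn) (jointE fq fn).
Qed.

Lemma jointDr p q n : finite_energy_radon p -> finite_energy_radon q ->
  finite_energy_radon n -> iint k n (measure_add p q) = (joint n p + joint n q)%:E.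
Proof.
move=> fp fq fn; rewrite (iintDr hX kk fn.1 fp.1 fq.1).
by rewrite (jointE fn fp) (jointE fn fq).
Qed.

Lemma joint_addl p q n : finite_energy_radon p -> finite_energy_radon q ->
  finite_energy_radon n -> joint (measure_add p q) n = (joint p n + joint q n)%R.
Proof. by move=> fp fq fn; rewrite {1}/joint jointDl. Qed.

Lemma joint_addr p q n : finite_energy_radon p -> finite_energy_radon q ->
  finite_energy_radon n -> joint n (measure_add p q) = (joint n p + joint n q)%R.
Proof. by move=> fp fq fn; rewrite {1}/joint jointDr. Qed.

Lemma finite_energy_radonD p q : finite_energy_radon p -> finite_energy_radon q ->
  finite_energy_radon (measure_add p q).
Proof.
move=> fp fq; have rpq := is_radon_add hX fp.1 fq.1; split=> //.
rewrite (iintDl hX kk fp.1 fq.1 rpq) jointDr// jointDr//.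
by rewrite -EFinD ltry.
Qed.

Lemma finite_energy_radon_le p q : is_radon p -> finite_energy_radon q ->
  (forall B, measurable B -> p B <= q B) -> finite_energy_radon p.
Proof. by move=> rp [rq qq] pq; split=> //; exact: (le_iint_lty hX kk rp rq rp rq). Qed.

Definition energy_diff mu p q :=
  [/\ radon_diff mu p q, finite_energy_radon p & finite_energy_radon q].

Lemma energy_diff_parts mu p q : radonM mu -> energy_diff mu p q ->
  exists P N, [/\ energy_diff mu P N, (P : set (Borel X) -> \bar R) = pospart mu &
        (N : set (Borel X) -> \bar R) = negpart mu].
Proof.
move=> rmu [d fp fq]; have [P [N [d' EP EN]]] := radon_parts hX rmu.
have [rP rN _] := d'; exists P, N; split=> //; split=> //.
  apply: (finite_energy_radon_le rP fp) => B mB; rewrite EP.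
  exact: pospart_le_radon d _.
apply: (finite_energy_radon_le rN fq) => B mB; rewrite EN.
exact: pospart_le_radon (radon_diffN hX d) _.
Qed.

(** Since [p + q' = p' + q], additivity shows that the energy against [n] does not depend on the
    representation of [mu]. *)
Lemma joint_diffl mu p q p' q' n : energy_diff mu p q -> energy_diff mu p' q' ->
  finite_energy_radon n -> (joint p n - joint q n = joint p' n - joint q' n)%R.
Proof.
move=> [d fp fq] [d' fp' fq'] fn.
have : iint k (measure_add p q') n = iint k (measure_add p' q) n.
  by apply: eq_iint => // B mB; rewrite !add_measureE; exact: radon_diff_eq d d' _ _.
rewrite !jointDl// => -[]; lra.
Qed.

Lemma joint_diffr mu p q p' q' n : energy_diff mu p q -> energy_diff mu p' q' ->
  finite_energy_radon n -> (joint n p - joint n q = joint n p' - joint n q')%R.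
Proof.
move=> [d fp fq] [d' fp' fq'] fn.
have : iint k n (measure_add p q') = iint k n (measure_add p' q).
  by apply: eq_iint => // B mB; rewrite !add_measureE; exact: radon_diff_eq d d' _ _.
rewrite !jointDr// => -[]; lra.
Qed.

(** Passing from the minimal parts to any representation of finite energy makes stability under sums
    and opposites visible. The parts lie below such a representation, and their cross term is finite
    by [mutual_fin_num]. *)
Lemma finite_energyP mu : finite_energy k mu <->
  radonM mu /\ exists p q, energy_diff mu p q.
Proof.
split=> [[rmu PP NN PN]|[rmu [p [q pq]]]]; last first.
  have [P [N [[_ fP fN] EP EN]]] := energy_diff_parts rmu pq.
  by split=> //; rewrite -?EP -?EN; exact: mutual_fin_num.
split=> //; have [P [N [d EP EN]]] := radon_parts hX rmu.
have [rP rN _] := d; exists P, N; split=> //; split=> //; rewrite ?EP ?EN.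
  by rewrite ltey_eq PP.
by rewrite ltey_eq NN.
Qed.

(** The parts of a sum are in general not the sums of the parts; freedom in the representation is
    what makes biadditivity provable. *)
Lemma mutual_energyE mu nu p q p' q' : radonM mu -> radonM nu ->
  energy_diff mu p q -> energy_diff nu p' q' ->
  mutual_energy k mu nu =
    ((joint p p' + joint q q') - (joint p q' + joint q p'))%:E.
Proof.
move=> rmu rnu dmu dnu.
have [P [N [d1 EP EN]]] := energy_diff_parts rmu dmu.
have [P' [N' [d2 EP' EN']]] := energy_diff_parts rnu dnu.
rewrite /mutual_energy -EP -EN -EP' -EN'.
have [[_ fp fq] [_ fp' fq']] := (dmu, dnu).
have [[_ fP fN] [_ fP' fN']] := (d1, d2).
rewrite !jointE//; congr (_%:E).
have := joint_diffl d1 dmu fP'; have := joint_diffl d1 dmu fN'.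
have := joint_diffr d2 dnu fp; have := joint_diffr d2 dnu fq.
lra.
Qed.

Lemma mutual_energy_fin_num mu nu : finite_energy k mu -> finite_energy k nu ->
  mutual_energy k mu nu \is a fin_num.
Proof.
move=> /finite_energyP[rmu [p [q d]]] /finite_energyP[rnu [p' [q' d']]].
by rewrite (mutual_energyE rmu rnu d d').
Qed.

Lemma finite_energyN mu : finite_energy k mu -> finite_energy k (- mu)%R.
Proof.
move=> /finite_energyP[rmu [p [q [d fp fq]]]]; apply/finite_energyP.
split; first exact: radonMN.
by exists q, p; split=> //; exact: radon_diffN.
Qed.

Lemma radon_diff_add mu nu p q p' q' : radon_diff mu p q -> radon_diff nu p' q' ->
  radon_diff (mu + nu)%R (measure_add p p') (measure_add q q').
Proof.
move=> d d'; have [rp rq h] := d; have [rp' rq' h'] := d'.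
split=> [||B bB]; [exact: is_radon_add|exact: is_radon_add|].
rewrite -[LHS]/((mu B + nu B)%:E) !add_measureE EFinD h// h'//.
by rewrite fin_num_oppeD ?(radon_fin_num hX)// addeACA.
Qed.

Lemma radonMD mu nu : radonM mu -> radonM nu -> radonM (mu + nu)%R.
Proof.
move=> [p [q [rp rq h h0]]] [p' [q' [rp' rq' h' h0']]].
have [] := @radon_diff_add mu nu p q p' q'; [by split|by split|move=> r1 r2 h2].
exists (measure_add p p'), (measure_add q q'); split=> // B bB.
by rewrite -[LHS]/(mu B + nu B)%R h0// h0'// addr0.
Qed.

Lemma energy_diffD mu nu p q p' q' : energy_diff mu p q -> energy_diff nu p' q' ->
  energy_diff (mu + nu)%R (measure_add p p') (measure_add q q').
Proof.
move=> [d fp fq] [d' fp' fq']; split; first exact: radon_diff_add.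
  exact: finite_energy_radonD.
exact: finite_energy_radonD.
Qed.

Lemma finite_energyD mu nu :
  finite_energy k mu -> finite_energy k nu -> finite_energy k (mu + nu)%R.
Proof.
move=> /finite_energyP[rmu [p [q d]]] /finite_energyP[rnu [p' [q' d']]].
apply/finite_energyP; split; first exact: radonMD.
by exists (measure_add p p'), (measure_add q q'); exact: energy_diffD.
Qed.

Lemma iint_mzero : iint k mzero mzero = 0.
Proof. by rewrite /iint integral_measure_zero. Qed.

Lemma finite_energy_mzero : finite_energy_radon mzero.
Proof. by split; [exact: is_radon_mzero|rewrite iint_mzero]. Qed.

Lemma finite_energy0 : finite_energy k 0%R.
Proof.
have rz := is_radon_mzero (R := R) hX.
have d : radon_diff (0%R : set X -> R) mzero mzero.
  by split=> // B _; rewrite /= /mzero sube0.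
apply/finite_energyP; split.
  by exists mzero, mzero; case: d.
by exists mzero, mzero; split=> //; exact: finite_energy_mzero.
Qed.

Definition energy_form mu nu : R := fine (mutual_energy k mu nu).

Lemma energy_formDl mu mu' nu :
  finite_energy k mu -> finite_energy k mu' -> finite_energy k nu ->
  energy_form (mu + mu')%R nu = (energy_form mu nu + energy_form mu' nu)%R.
Proof.
move=> /finite_energyP[r1 [p1 [q1 d1]]] /finite_energyP[r2 [p2 [q2 d2]]].
move=> /finite_energyP[r [p [q d]]].
rewrite /energy_form (mutual_energyE (radonMD r1 r2) r (energy_diffD d1 d2) d).
rewrite (mutual_energyE r1 r d1 d) (mutual_energyE r2 r d2 d) /=.
have [[_ f1 g1] [_ f2 g2] [_ f g]] := And3 d1 d2 d.
rewrite !joint_addl//; lra.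
Qed.

Lemma energy_formDr mu nu nu' :
  finite_energy k mu -> finite_energy k nu -> finite_energy k nu' ->
  energy_form mu (nu + nu')%R = (energy_form mu nu + energy_form mu nu')%R.
Proof.
move=> /finite_energyP[r [p [q d]]].
move=> /finite_energyP[r1 [p1 [q1 d1]]] /finite_energyP[r2 [p2 [q2 d2]]].
rewrite /energy_form (mutual_energyE r (radonMD r1 r2) d (energy_diffD d1 d2)).
rewrite (mutual_energyE r r1 d d1) (mutual_energyE r r2 d d2) /=.
have [[_ f1 g1] [_ f2 g2] [_ f g]] := And3 d1 d2 d.
rewrite !joint_addr//; lra.
Qed.

Lemma finite_energy_defined mu : finite_energy k mu -> mutual_energy_defined k mu mu.
Proof. by move=> [_ PP NN _]; left; rewrite fin_numD PP. Qed.

Lemma energy_form_ge0 mu : finite_energy k mu -> (0 <= energy_form mu mu)%R.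
Proof.
move=> fmu; have [rmu _ _ _] := fmu.
by have [h _] := spdk rmu (finite_energy_defined fmu); exact: fine_ge0.
Qed.

Lemma energy_form_eq0 mu : finite_energy k mu -> energy_form mu mu = 0%R ->
  mu = (fun=> 0%R).
Proof.
move=> fmu mu0; have [rmu _ _ _] := fmu.
have [_] := spdk rmu (finite_energy_defined fmu); apply.
by rewrite -[LHS]fineK ?mutual_energy_fin_num// -[fine _]/(energy_form mu mu) mu0.
Qed.

End energy.

(** * Positive measures and capacity *)

Lemma negligible_fin_bigcup d (T : ringOfSetsType d) (R : realFieldType)
    (mu : {content set T -> \bar R}) (J : choiceType) (D : set J) (F : J -> set T) :
  finite_set D -> (forall j, D j -> mu.-negligible (F j)) ->
  mu.-negligible (\bigcup_(j in D) F j).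
Proof.
move=> fD h; rewrite -bigsetU_fset_set//.
rewrite big_seq; elim/big_ind : _ => [||j].
- exact: negligible_set0.
- by move=> A B; exact: negligibleU.
- by rewrite in_fset_set// inE; exact: h.
Qed.

Section positive_measures.
Context {R : realType} {X : ptopologicalType}.
Hypothesis hX : hausdorff_space X.
Implicit Types (mu : set X -> R) (p P : {measure set (Borel X) -> \bar R}).

Lemma radon_negligible p (B : set (Borel X)) : is_radon p -> measurable B ->
  (forall K : set X, compact K -> K `<=` B -> p.-negligible K) -> p B = 0.
Proof.
move=> rp mB h; apply/eqP; rewrite eq_le measure_ge0 andbT.
apply: lee_lt_real => b /(radon_lt rp mB)[K [cK KB bK]].
apply: (le_trans (ltW bK)).
by rewrite (measure_negligible _ (h _ cK KB))//; exact: compact_borel.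
Qed.

Lemma negpart_pos mu : radonMpos mu -> negpart mu = mzero.
Proof.
move=> [rmu mu0]; have [p [q [rp rq h _]]] := rmu.
have d : radon_diff mu p q by [].
apply/funext => B; apply/eqP; rewrite eq_le; apply/andP; split.
  by apply: pospart_le => C _ _; rewrite lee_fin oppr_le0.
exact: pospart_ge0 (radon_diffN hX d).
Qed.

Lemma totvar_pos mu : radonMpos mu -> totvar mu = pospart mu.
Proof. by move=> /negpart_pos h; apply/funext => B; rewrite /totvar h /mzero adde0. Qed.

Lemma radonMpos_parts mu : radonMpos mu -> exists P : {measure set (Borel X) -> \bar R},
  radon_diff mu P mzero /\ (P : set (Borel X) -> \bar R) = pospart mu.
Proof.
move=> mu0; have [P [N [[rP rN h] EP EN]]] := radon_parts hX mu0.1.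
exists P; split=> //; split=> [//||B bB]; first exact: is_radon_mzero.
by rewrite h//; congr (_ - _); rewrite EN negpart_pos.
Qed.

Lemma radonMpos_sub p : is_radon p -> radonMpos (radon_sub p mzero).
Proof.
move=> rp; split; first by apply: radonM_sub => //; exact: is_radon_mzero.
by move=> B; rewrite /radon_sub; case: ifP => // _; rewrite /= /mzero subr0 fine_ge0.
Qed.

(* An uncountable union of null open sets is null, by inner regularity. *)
Lemma supported_byP mu P (F : set X) : radonMpos mu -> is_radon P ->
  (P : set (Borel X) -> \bar R) = pospart mu -> closed F ->
  supported_by mu F <-> P (~` F) = 0.
Proof.
move=> mu0 rP EP cF; have mF : measurable (~` F : set (Borel X)).
  by apply: measurableC; exact: closed_borel.
split=> [sF|PF x Fx].
  apply: radon_negligible => // K; rewrite compact_cover => cK KF.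
  have [||D' D'D KD'] := cK (set X) [set U | open U /\ P U = 0] id.
  - by move=> U [].
  - move=> x /KF Fx; apply: contrapT => h; apply: Fx; apply: sF => U oU Ux.
    rewrite totvar_pos// -EP lt_neqAle measure_ge0 andbT eq_sym.
    by apply/eqP => PU; apply: h; exists U.
  apply: (@negligibleS _ (Borel X) R P _ _ KD').
  apply: (@negligible_fin_bigcup _ (Borel X)); first exact: finite_fset.
  move=> U /D'D; rewrite inE => -[oU PU]; apply/negligibleP => //.
  exact: open_borel.
apply: contrapT => nFx; have := Fx (~` F) (closed_openC cF) nFx.
by rewrite totvar_pos// -EP PF ltxx.
Qed.

Lemma carried_by_null mu P (Q : set X) : radonMpos mu -> is_radon P ->
  (P : set (Borel X) -> \bar R) = pospart mu -> measurable (Q : set (Borel X)) ->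
  carried_by mu Q -> P (~` Q) = 0.
Proof.
move=> mu0 rP EP mQ cQ; apply: radon_negligible => //; first exact: measurableC.
move=> K cK KQ; have := cQ _ cK; rewrite totvar_pos// -EP.
by apply: negligibleS => x Kx; split => //; exact: KQ.
Qed.

End positive_measures.

Section capacity.
Context {R : realType} {X : ptopologicalType}.
Hypothesis hX : hausdorff_space X.
Variable k : X * X -> \bar R.
Hypothesis kk : potential_kernel k.
Hypothesis spdk : strictly_positive_definite k.
Implicit Types (mu : set X -> R) (p P : {measure set (Borel X) -> \bar R}).

Lemma positive_energyE mu P : radonMpos mu -> (P : set (Borel X) -> \bar R) = pospart mu ->
  energy k mu = iint k P P.
Proof.
move=> mu0 EP; rewrite /energy /mutual_energy negpart_pos// -EP.
have z (f : Borel X -> \bar R) : \int[mzero]_y f y = 0.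
  exact: integral_measure_zero.
have zr : iint k P mzero = 0.
  by rewrite /iint; under eq_integral do rewrite z; exact: integral0.
have zl p : iint k mzero p = 0 by exact: z.
by rewrite zr !zl !adde0 sube0.
Qed.

Lemma positive_energy_diff mu : radonMpos mu -> energy k mu < +oo ->
  exists P, energy_diff k mu P mzero /\ (P : set (Borel X) -> \bar R) = pospart mu.
Proof.
move=> mu0 emu; have [P [d EP]] := radonMpos_parts hX mu0.
exists P; split=> //; split=> //; last exact: finite_energy_mzero.
by have [rP _ _] := d; split; rewrite // -(positive_energyE mu0 EP).
Qed.

Lemma positive_finite_energy mu : radonMpos mu -> energy k mu < +oo -> finite_energy k mu.
Proof.
move=> mu0 /(positive_energy_diff mu0)[P [d _]]; apply/finite_energyP => //.
by split; [case: mu0|exists P, mzero].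
Qed.

(** The inverse vanishes only at [+oo], and any admissible measure keeps the infimum below its own
    finite energy. *)
Lemma capacity_eq0P (Q : set X) : capacity k Q = 0 <->
  ~ exists mu, [/\ radonMpos mu, finite_energy k mu, carried_by mu Q & pospart mu Q = 1].
Proof.
split=> [c0 [mu h]|h]; rewrite /capacity.
  have fe : finite_energy k mu by case: h.
  have : energy k mu \is a fin_num by exact: mutual_energy_fin_num.
  move/eqP : c0; rewrite /capacity inve_eq0 => /eqP inf.
  have : ereal_inf [set energy k mu | mu in
     [set mu : set X -> R | [/\ radonMpos mu, finite_energy k mu,
                                carried_by mu Q & pospart mu Q = 1]]] <= energy k mu.
    by apply: ereal_inf_lbound; exists mu.
  by rewrite inf leye_eq => /eqP ->.
rewrite [X in ereal_inf X](_ : _ = set0) ?ereal_inf0 ?invey//.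
by apply/seteqP; split=> // x [mu hmu _]; apply: h; exists mu.
Qed.

(** If [P Q] were positive, some compact [K] inside [Q] would have positive finite mass. The
    restriction of [P] to [K] lies below [P], so it has finite energy, and division by [P K] makes
    it admissible for the capacity of [Q]. *)
Lemma capacity0_null (Q : set X) mu P : measurable (Q : set (Borel X)) ->
  capacity k Q = 0 -> energy_diff k mu P mzero -> P Q = 0.
Proof.
move=> mQ /capacity_eq0P cQ [d fP _]; apply: contrapT => /eqP PQ; apply: cQ.
have [rP _] := fP.
have PQ0 : 0%:E < P Q by rewrite lt_neqAle eq_sym PQ measure_ge0.
have [K [cK KQ PK]] := radon_lt rP mQ PQ0.
have mK := compact_borel hX cK.
have PKfin : P K \is a fin_num by exact: radon_fin_num (compact_bounded_borel hX cK).
have c0 : (0 <= (fine (P K))^-1)%R by rewrite invr_ge0 fine_ge0.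
pose m : {measure set (Borel X) -> \bar R} := mscale (NngNum c0) (mrestr P mK).
have mE B : m B = (fine (P K))^-1%:E * P (B `&` K) by [].
have rr : is_radon (mrestr P mK) by exact: is_radon_mrestr.
have rm : is_radon m by exact: is_radon_mscale.
have fr : finite_energy_radon k (mrestr P mK).
  apply: (finite_energy_radon_le hX kk rr fP) => B mB.
  by apply: le_measure; rewrite ?inE//; exact: measurableI.
have fm : finite_energy_radon k m.
  by split=> //; apply: iint_mscale_lty => //; case: fr.
have rz := is_radon_mzero (R := R) hX.
exists (radon_sub m mzero); split.
- exact: radonMpos_sub.
- apply/finite_energyP => //; split; first exact: radonM_sub.
  exists m, mzero; split=> //; first exact: radon_diff_sub.
  exact: finite_energy_mzero.
- move=> L cL; have mL := compact_borel hX cL.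
  have mLQ : measurable (L `\` Q : set (Borel X)) by exact: measurableD.
  exists (L `\` Q); split=> //.
  rewrite totvar_pos//; last exact: radonMpos_sub.
  rewrite pospart_radon_sub0// mE (_ : (L `\` Q) `&` K = set0) ?measure0 ?mule0//.
  by apply/seteqP; split=> // x [[_ Qx] /KQ].
- rewrite pospart_radon_sub0// mE setIidr//.
  rewrite -[X in _ * X]fineK// -EFinM mulVf//.
  apply: lt0r_neq0; apply: fine_gt0; apply/andP; split; last by rewrite -ge0_fin_numE.
  exact: PK.
Qed.

End capacity.

(** * Vector measures on a condenser *)

Section condenser.
Context {R : realType} {X : ptopologicalType} {I : finType}.
Hypothesis hX : hausdorff_space X.
Variable k : X * X -> \bar R.
Hypothesis kk : potential_kernel k.
Hypothesis spdk : strictly_positive_definite k.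
Variables (A : I -> set X) (s : I -> R).
Hypothesis s1 : forall i, s i = 1%R \/ s i = (-1)%R.
Implicit Types (mu nu : I -> set X -> R).

Local Notation E := (finite_energy k).
Local Notation B := (energy_form k).
Let E0 : E 0%R := finite_energy0 hX kk spdk.
Let EN v := @finite_energyN R X hX k kk spdk v.
Let ED v w := @finite_energyD R X hX k kk spdk v w.
Let BDl u v w := @energy_formDl R X hX k kk spdk u v w.
Let BDr u v w := @energy_formDr R X hX k kk spdk u v w.
Let B0 v := @energy_form_ge0 R X k spdk v.

(** Written with the opposite instead of a scalar product because the energy form is handled as a
    biadditive form only. *)
Definition sgn_mul (e : R) (v : set X -> R) : set X -> R := if e == 1%R then v else (- v)%R.

Let sgn_mulE i v C : sgn_mul (s i) v C = (s i * v C)%R.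
Proof.
rewrite /sgn_mul; case: eqP => [->|]; first by rewrite mul1r.
by case: (s1 i) => // -> _; rewrite mulN1r.
Qed.

Let sgn_mul_closed e v : E v -> E (sgn_mul e v).
Proof. by rewrite /sgn_mul; case: ifP => // _; exact: EN. Qed.

Lemma vector_measures_finite_energy mu i : vector_measures k A mu -> E (mu i).
Proof. by move=> /(_ i)[mu0 _ emu]; exact: positive_finite_energy. Qed.

Lemma Rmap_diff mu nu :
  (Rmap s mu \- Rmap s nu)%R = (\sum_i sgn_mul (s i) (mu i - nu i)%R)%R.
Proof.
rewrite fct_sumE; apply/funext => C; rewrite /Rmap/= -sumrB.
by apply: eq_bigr => i _; rewrite sgn_mulE -mulrBr.
Qed.

Lemma RmapE mu : Rmap s mu = (\sum_i sgn_mul (s i) (mu i))%R.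
Proof.
by rewrite fct_sumE; apply/funext => C; apply: eq_bigr => i _; rewrite sgn_mulE.
Qed.

Let diff_closed mu nu i :
  vector_measures k A mu -> vector_measures k A nu -> E (mu i - nu i)%R.
Proof. by move=> hmu hnu; apply: ED; [|apply: EN]; exact: vector_measures_finite_energy. Qed.

Lemma Rmap_finite_energy mu : vector_measures k A mu -> E (Rmap s mu).
Proof.
move=> hmu; rewrite RmapE; apply: biadd_sum_closed => // i.
by apply: sgn_mul_closed; exact: vector_measures_finite_energy.
Qed.

Lemma Rmap_diff_finite_energy mu nu : vector_measures k A mu -> vector_measures k A nu ->
  E (Rmap s mu \- Rmap s nu)%R.
Proof.
move=> hmu hnu; rewrite Rmap_diff; apply: biadd_sum_closed => // i.
by apply: sgn_mul_closed; exact: diff_closed.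
Qed.

Let form_sgnl i v w : E v -> E w -> B (sgn_mul (s i) v) w = (s i * B v w)%R.
Proof.
move=> Ev Ew; rewrite /sgn_mul; case: eqP => [->|]; first by rewrite mul1r.
case: (s1 i) => // -> _; rewrite mulN1r.
exact: (biaddNl E0 EN BDl Ev Ew).
Qed.

Let form_sgnr i v w : E v -> E w -> B v (sgn_mul (s i) w) = (s i * B v w)%R.
Proof.
move=> Ev Ew; rewrite /sgn_mul; case: eqP => [->|]; first by rewrite mul1r.
case: (s1 i) => // -> _; rewrite mulN1r.
exact: (biaddNr E0 EN BDr Ev Ew).
Qed.

Lemma vector_dist_sqr mu nu : vector_measures k A mu -> vector_measures k A nu ->
  (vector_dist k s mu nu ^+ 2)%:E =
  \sum_i \sum_j (s i * s j)%:E * mutual_energy k (mu i \- nu i)%R (mu j \- nu j)%R.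
Proof.
move=> hmu hnu; rewrite /vector_dist /energy_norm sqr_sqrtr; last first.
  by apply: B0; exact: Rmap_diff_finite_energy.
rewrite -[fine _]/(B _ _) Rmap_diff.
have Ed i : E (mu i - nu i)%R := diff_closed i hmu hnu.
rewrite (biadd_suml E0 ED BDl)//; last 2 first.
- by move=> i; exact: sgn_mul_closed.
- by apply: biadd_sum_closed => // i; exact: sgn_mul_closed.
rewrite -sumEFin; apply: eq_bigr => i _.
rewrite (biadd_sumr E0 ED BDr)//; last 2 first.
- exact: sgn_mul_closed.
- by move=> j; exact: sgn_mul_closed.
rewrite -sumEFin; apply: eq_bigr => j _.
rewrite form_sgnl ?form_sgnr//; last exact: sgn_mul_closed.
rewrite mulrA EFinM /B /energy_form fineK//.
by apply: mutual_energy_fin_num => //; exact: diff_closed.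
Qed.

Lemma vector_dist_semimetric :
  semimetric_on (vector_measures k A) (vector_dist k s).
Proof.
split=> [mu nu _ _|mu hmu|mu nu hmu hnu|x y z hx hy hz].
- exact: sqrtr_ge0.
- rewrite /vector_dist /energy_norm (_ : (Rmap s mu \- Rmap s mu)%R = 0%R); last first.
    by apply/funext => C /=; rewrite subrr.
  by rewrite -[fine _]/(B 0%R 0%R) (biadd0l E0 BDl E0) sqrtr0.
- rewrite /vector_dist /energy_norm; congr (Num.sqrt _).
  rewrite -[LHS]/(B _ _) -[RHS]/(B _ _).
  rewrite (_ : (Rmap s mu \- Rmap s nu)%R = (- (Rmap s nu \- Rmap s mu))%R); last first.
    by apply/funext => C /=; rewrite -[RHS]/(- (_ - _))%R opprB.
  have := Rmap_diff_finite_energy hnu hmu.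
  exact: (biadd_oppr_diag E0 EN BDl BDr).
- rewrite /vector_dist (_ : (Rmap s x \- Rmap s z)%R =
      ((Rmap s x \- Rmap s y) + (Rmap s y \- Rmap s z))%R); last first.
    by apply/funext => C /=; rewrite -[RHS]/(_ - _ + (_ - _))%R addrA subrK.
  have := Rmap_diff_finite_energy hx hy; have := Rmap_diff_finite_energy hy hz.
  move=> h1 h2; exact: (biadd_triangle E0 EN ED BDl BDr B0 h2 h1).
Qed.

End condenser.

(** * Separation of vector measures and essentially disjoint plates *)

Section metric.
Context {R : realType} {X : ptopologicalType} {I : finType}.
Hypothesis hX : hausdorff_space X.
Variable k : X * X -> \bar R.
Hypothesis kk : potential_kernel k.
Hypothesis spdk : strictly_positive_definite k.
Variables (A : I -> set X) (s : I -> R).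
Hypothesis cA : forall i, closed (A i).
Hypothesis s1 : forall i, s i = 1%R \/ s i = (-1)%R.
Implicit Types mu nu : I -> set X -> R.

Let mA i : measurable (A i : set (Borel X)). Proof. exact: closed_borel. Qed.

(* On the part of the i-th plate outside the other plates only the i-th component
   is seen by [Rmap], and the rest of the plate is null. *)
Lemma Rmap_recover mu (i : I) (C : set X) :
  (forall i j, i != j -> capacity k (A i `&` A j) = 0) ->
  vector_measures k A mu -> bounded_borel C ->
  Rmap s mu (C `&` (A i `\` \bigcup_(j in [set j | j != i]) A j)) = (s i * mu i C)%R.
Proof.
move=> capA hmu bC; have [mC _] := bC.
set U := \bigcup_(j in _) A j; set C' := C `&` _.
have mU : measurable (U : set (Borel X)).
  by apply: fin_bigcup_measurable => //; exact: finite_finset.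
have mC' : measurable (C' : set (Borel X)).
  by apply: measurableI => //; exact: measurableD.
have bC' : bounded_borel C' by apply: (sub_bounded_borel bC) => // x [].
have rep j : exists P, energy_diff k (mu j) P mzero /\ P (~` A j) = 0.
  have [mu0 sA emu] := hmu j.
  have [P [d EP]] := positive_energy_diff hX mu0 emu.
  exists P; split=> //; have [[rP _ _] _ _] := d.
  exact: ((supported_byP hX mu0 rP EP (@cA j)).1 sA).
(* The set [C'] avoids [A j], off which the [j]-th component is null. *)
have null_other j : j != i -> mu j C' = 0%R.
  move=> ji; have [P [[[rP _ h] _ _] PA]] := rep j.
  apply: EFin_inj; rewrite h// sube0; apply: measure_negligible => //.
  apply: (@negligibleS _ (Borel X) R P (~` A j)).
    by move=> x [_ [_ nU]] Ajx; apply: nU; exists j.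
  by apply/negligibleP => //; exact: measurableC.
rewrite /Rmap (bigD1 i)//= big1 ?addr0; last first.
  by move=> j ji; rewrite null_other// mulr0.
congr (_ * _)%R; have [P [d PA]] := rep i; have [[rP _ h] _ _] := d.
apply: EFin_inj; rewrite !h// !sube0.
have -> : P C = P (C `\` C') + P (C `&` C') := measureDI P mC mC'.
rewrite [C `&` C'](_ : _ = C'); last first.
  by rewrite /C' setIA setIid.
rewrite (_ : P (C `\` C') = 0) ?add0e//.
apply: measure_negligible; first exact: measurableD.
(* A lost point of [C] lies off [A i], which is null by the support condition, or on another plate
   as well, which is null by zero capacity. *)
apply: (@negligibleS _ (Borel X) R P (~` A i `|` \bigcup_(j in [set j | j != i]) (A i `&` A j))).
  move=> x [Cx nC']; have [Ax|nAx] := pselect (A i x); last by left.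
  right; apply: contrapT => nx; apply: nC'; split=> //; split=> // -[j ji Ajx].
  by apply: nx; exists j.
apply: negligibleU; first by apply/negligibleP => //; exact: measurableC.
apply: negligible_fin_bigcup; first exact: finite_finset.
move=> j /= ji; apply/negligibleP; first exact: measurableI.
apply: (capacity0_null hX kk spdk _ _ d); first exact: measurableI.
by apply: capA; rewrite eq_sym.
Qed.

Lemma essentially_disjoint_metric :
  (forall i j, i != j -> capacity k (A i `&` A j) = 0) ->
  metric_on (vector_measures k A) (vector_dist k s).
Proof.
move=> capA; split; first exact: vector_dist_semimetric.
move=> mu nu hmu hnu d0; have Ed := Rmap_diff_finite_energy hX kk spdk s1 hmu hnu.
have /(energy_form_eq0 hX kk spdk Ed) D0 :
    energy_form k (Rmap s mu \- Rmap s nu)%R (Rmap s mu \- Rmap s nu)%R = 0%R.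
  (* [Num.sqrt] also vanishes at negative reals, so a zero distance only bounds the energy from
     above; positivity supplies the other inequality. *)
  apply/eqP; rewrite eq_le (energy_form_ge0 spdk Ed) andbT.
  by rewrite -sqrtr_eq0; apply/eqP.
apply/funext => i; apply/funext => C.
(* Off the bounded Borel sets both components are 0 by the convention in [radonM]. *)
have [bC|nbC] := pselect (bounded_borel C); last first.
  have [[[p [q [_ _ _ ->//]]] _] _ _] := hmu i.
  by have [[[p' [q' [_ _ _ ->//]]] _] _ _] := hnu i.
have si0 : s i != 0%R by case: (s1 i) => ->; rewrite ?oppr_eq0 oner_eq0.
apply: (mulfI si0); rewrite -!Rmap_recover//.
apply/eqP; rewrite -subr_eq0; apply/eqP.
by rewrite -[LHS]/((Rmap s mu \- Rmap s nu)%R _) D0.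
Qed.

Definition single_measure (m : set X -> R) (i : I) : I -> set X -> R :=
  fun l => if l == i then m else 0%R.

Lemma Rmap_single m i : Rmap s (single_measure m i) = (fun C => s i * m C)%R.
Proof.
apply/funext => C; rewrite /Rmap (bigD1 i)//= big1 ?addr0.
  by rewrite /single_measure eqxx.
by move=> j /negbTE ji; rewrite /single_measure ji mulr0.
Qed.

(** An intersection of nonzero capacity carries a unit measure [m] of finite energy. Equal signs
    contradict separation; opposite signs contradict the condenser condition. *)
Lemma metric_essentially_disjoint :
  capacity k (same_sign A s 1 `&` same_sign A s (- 1)) = 0 ->
  metric_on (vector_measures k A) (vector_dist k s) ->
  forall i j, i != j -> capacity k (A i `&` A j) = 0.
Proof.
move=> cap0 [semi sep] i j ij; apply/(capacity_eq0P hX kk spdk) => -[m [m0 fm cm m1]].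
have em : energy k m < +oo.
  have : energy k m \is a fin_num by exact: (mutual_energy_fin_num hX kk spdk).
  by rewrite fin_numElt => /andP[].
have [P [d EP]] := positive_energy_diff hX m0 em; have [[rP _ _] _ _] := d.
have PQ : P (~` (A i `&` A j)) = 0.
  by apply: (carried_by_null hX m0 rP EP) => //; exact: measurableI.
have sA l : (A i `&` A j) `<=` A l -> supported_by m (A l).
  move=> sub; apply/(supported_byP hX m0 rP EP (@cA l)).
  apply: measure_negligible; first exact: measurableC.
  apply: (@negligibleS _ (Borel X) R P (~` (A i `&` A j))); first exact: subsetC.
  by apply/negligibleP => //; apply: measurableC; exact: measurableI.
have [sij|sij] := eqVneq (s i) (s j).
  have zero0 : radonMpos (0%R : set X -> R).
    by split=> //; have [] := finite_energy0 hX kk spdk.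
  have vec l : (A i `&` A j) `<=` A l -> vector_measures k A (single_measure m l).
    move=> sub l'; rewrite /single_measure; case: eqP => [->|_].
      by split=> //; exact: sA.
    split=> //.
      move=> x Ux; exfalso; have := Ux setT openT Logic.I.
      rewrite totvar_pos// ltNge; apply/negP; rewrite negbK.
      by apply: pospart_le.
    have : energy k (0%R : set X -> R) \is a fin_num.
      by apply: (mutual_energy_fin_num hX kk spdk); exact: finite_energy0.
    by rewrite fin_numElt => /andP[].
  have vi := vec i (@subIsetl _ _ _); have vj := vec j (@subIsetr _ _ _).
  (* Placing [m] on plate [i] or on plate [j] gives the same R-image, so the distance is that of a
     vector to itself, and separation forces [m = 0]. *)
  have := sep _ _ vi vj; rewrite /vector_dist !Rmap_single sij.
  have [_ + _ _] := semi; move/(_ _ vi); rewrite /vector_dist Rmap_single sij => -> /(_ erefl).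
  move/(congr1 (fun f => f i)); rewrite /single_measure eqxx (negbTE ij) => m00.
  have : pospart m (A i `&` A j) <= 0 by rewrite m00; exact: pospart_le.
  by rewrite m1 lee_fin ler10.
(* With opposite signs, [m] would give mass 1 to a subset of the intersection of the two signed
   unions, which is null for it. *)
have mS e : measurable (same_sign A s e : set (Borel X)).
  by apply: fin_bigcup_measurable => //; exact: finite_finset.
have := capacity0_null hX kk spdk (measurableI _ _ (mS 1%R) (mS (-1)%R)) cap0 d.
have : P (A i `&` A j) <= P (same_sign A s 1 `&` same_sign A s (- 1)).
  apply: le_measure; rewrite ?inE; [exact: measurableI|exact: measurableI|].
  move=> x [Ai Aj]; case: (s1 i) (s1 j) sij => [si|si] [sj|sj]; rewrite si sj ?eqxx// => _.
    by split; [exists i|exists j].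
  by split; [exists j|exists i].
by rewrite EP m1 => /[swap] ->; rewrite lee_fin ler10.
Qed.

End metric.

Theorem theorem3p9 (R : realType) (X : ptopologicalType)
    (k : X * X -> \bar R) (I : finType) (A : I -> set X) (s : I -> R)
    (hausX : hausdorff_space X) (lcX : locally_compact [set: X])
    (kerk : potential_kernel k) (spdk : strictly_positive_definite k)
    (condA : generalized_condenser k A s)
    (capA : forall i, 0 < capacity k (A i)) :
  [/\ semimetric_on (vector_measures k A) (vector_dist k s),
      forall mu mu1, vector_measures k A mu -> vector_measures k A mu1 ->
        finite_energy k (Rmap s mu \- Rmap s mu1)%R /\
        (vector_dist k s mu mu1 ^+ 2)%:E =
        \sum_i \sum_j (s i * s j)%:E *
          mutual_energy k (mu i \- mu1 i)%R (mu j \- mu1 j)%R,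
      Rmap s @` vector_measures k A `<=` finite_energy k /\
      isometry_onto (vector_measures k A) (vector_dist k s)
        (Rmap s @` vector_measures k A) (energy_dist k) (Rmap s) &
      metric_on (vector_measures k A) (vector_dist k s) <->
      (forall i j, i != j -> capacity k (A i `&` A j) = 0)].
Proof.
have [_ cA s1 cap0] := condA; split.
- exact: vector_dist_semimetric.
- move=> mu mu1 hmu hmu1; split; first exact: Rmap_diff_finite_energy.
  exact: vector_dist_sqr.
- split; first by move=> _ [mu hmu <-]; exact: (Rmap_finite_energy hausX kerk spdk s1 hmu).
  by split.
- split; first exact: metric_essentially_disjoint.
  exact: essentially_disjoint_metric.
Qed.
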